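(* Let $p>3$ be a prime. Then $$\sum_{k=0}^{(p-1)/2}\frac{\binom{2k}k}{8^k}\equiv\left(\frac 2p\right)+\left(\frac{-2}p\right)\frac{p^2}4E_{p-3}\pmod{p^3},$$ $$\sum_{k=0}^{(p-1)/2}\frac{\binom{2k}k^2}{16^k}\equiv(-1)^{(p-1)/2}+p^2E_{p-3}\pmod{p^3},$$ $$\sum_{k=0}^{(p-1)/2}\frac{k\binom{2k}k^2}{16^k}\equiv\frac{(-1)^{(p+1)/2}}4+\frac{p^2}4(1-E_{p-3})\pmod{p^3},$$ $$\sum_{p/2<k<p}\frac{\binom{2k}k^2}{16^k}\equiv-2p^2E_{p-3}\pmod{p^3},\qquad \sum_{p/2<k<p}\frac{k\binom{2k}k^2}{16^k}\equiv\frac{p^2}2 E_{p-3}\pmod{p^3}.$$ Furthermore, $$(-1)^{(p-1)/2}\sum_{k=0}^{(p-1)/2}\frac{\binom{2k}k^2}{16^k}\equiv 1-\frac38p\sum_{k=1}^{(p-1)/2}\frac{\binom{2k}k}k\pmod{p^4}$$ and $$\sum_{k=0}^{(p-1)/2}\frac{k\binom{2k}k^2}{16^k}\equiv\frac{(-1)^{(p+1)/2}}4+\frac{p^2}4(2^{p}-1)+(-1)^{(p-1)/2}\frac 3{32}p\sum_{k=1}^{(p-1)/2}\frac{\binom{2k}k}k\pmod{p^4}.$$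
   Context: $\left(\frac{\cdot}{p}\right)$ denotes the Legendre (Jacobi) symbol. Euler numbers $E_n$ are the integers defined by $E_0=1$ and $\sum_{0\le k\le n,\ 2\mid k}\binom nk E_{n-k}=0$ for $n\ge1$. A congruence $a\equiv b\pmod{p^m}$ between rationals with denominators prime to $p$ means $(a-b)/p^m$ has denominator prime to $p$. *)

(* Defs.v *)
From mathcomp Require Import all_boot all_order all_algebra.

Set Implicit Arguments.
Unset Strict Implicit.
Unset Printing Implicit Defensive.

Import Order.TTheory GRing.Theory Num.Theory.
Local Open Scope ring_scope.

(* The Euler numbers in reverse order, [:: E_n; E_(n-1); ...; E_0], so that
   the entry of index k.-1 in euler_rev n is E_(n.+1 - k) for 1 <= k <= n.+1. *)
Fixpoint euler_rev (n : nat) : seq int :=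
  match n with
  | 0%N => [:: 1]
  | m.+1 =>
      let s := euler_rev m in
      (- \sum_(1 <= k < m.+2 | ~~ odd k) 'C(m.+1, k)%:R * s`_k.-1) :: s
  end.

Definition euler (n : nat) : int := (euler_rev n)`_0.

Lemma nth_euler_rev n k : (k <= n)%N -> (euler_rev n)`_k = euler (n - k).
Proof.
elim: n k => [|n IHn] [|k] //= le_kn.
by rewrite IHn // subSS.
Qed.

Lemma euler0 : euler 0 = 1.
Proof. by []. Qed.

Lemma euler_sum0 n : (1 <= n)%N ->
  \sum_(0 <= k < n.+1 | (2 %| k)%N) 'C(n, k)%:R * euler (n - k) = 0.
Proof.
case: n => // n _; rewrite big_ltn_cond //= bin0 mul1r subn0.
rewrite {1}/euler /= addrC; apply/eqP; rewrite subr_eq0; apply/eqP.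
rewrite [LHS]big_nat_cond [RHS]big_nat_cond.
apply: eq_big => [k|k]; first by rewrite dvdn2.
case/andP=> /andP[]; case: k => // k _ lt_kn _ /=.
by rewrite nth_euler_rev // subSS.
Qed.

Definition legendre (a : int) (p : nat) : int :=
  if (p %| a)%Z then 0
  else if [exists x : 'I_p, ((x : nat)%:Z ^+ 2 == a %[mod p])%Z] then 1
  else -1.

(* a is congruent to b modulo p ^ m, for rationals a and b whose denominators
   are prime to p. *)
Definition ratcong (p m : nat) (a b : rat) : Prop :=
  coprime p `|denq ((a - b) / p%:R ^+ m)|%N.

(* Main.v *)
Require Import Defs.
From HB Require Import structures.
From mathcomp Require Import all_boot all_order all_algebra.
From mathcomp Require Import ring lra zify.

(* Write [p = 2n + 1], [e_k = C(2k, k) / 4^k], [O_k = sum_(l < k) 1 / (2l + 1)]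
   and [T = sum_(1 <= k <= n) C(2k, k) / k].  Since
     [C(n + k, k) = e_k prod_(l < k) (1 + p / (2l + 1))] and
     [(-1)^k C(n, k) = e_k prod_(l < k) (1 - p / (2l + 1))],
   every sum in the theorem is a [p]-adic perturbation of an exactly summable
   binomial sum.
   - [sum_(k <= n) e_k^2 = p e_n sum_(k <= n) e_k / (p - 2k)], and the same sum
     with [(-1)^k C(n, k)] in place of [e_k] on the right is [(-1)^n]; likewise
     [3 T / 2 = sum_k (C(n + k, k) - (-1)^k C(n, k)) / k].  Expanding in [p],
     both [(-1)^n sum e_k^2 - 1] and [- 3 p T / 8] become
     [- p^2 / 2 * sum e_k O_k / k] modulo [p^4]; the coefficients of [p^3] agree
     because, after an alternating binomial transform, their difference is a
     multiple of [O_n + H_n / 2], with [H_n] the harmonic number, and this is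
     divisible by [p].
   - Modulo [p], [sum e_k O_k / k] is [- sum_(j <= n) (-1)^j / j^2], and a
     telescoping of the umbral polynomial [(E + y)^(p - 3)] identifies this with
     [- 2 (-1)^n E_(p-3)].
   - For [n < k < p], [e_k / p] is modulo [p] the inverse of
     [- 2 (p - k) e_(p - k)],
     which turns the upper sum into [p^2 / 4 * sum 1 / (i C(n, i))^2]; Staver's
     identity evaluates it through [T].
   - [sum (4k + 1) e_k^2] telescopes, which gives the sums weighted by [k].
   - The sum of [C(2k, k) / 8^k] is compared in the same way with
     [sum C(n + k, k) / 2^k = 2^n] and [sum (-1)^k C(n, k) / 2^k = 2^(-n)]. *)

Import Order.TTheory GRing.Theory Num.Theory.
Local Open Scope ring_scope.

(** * Exact binomial and harmonic identities *)

(** For the side conditions of [field]: a vanishing denominator contradicts the linear bounds in the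
    context, which is why facts such as [ler0n] are introduced first. *)
Ltac nonzero :=
  repeat (apply/andP; split);
  first [by [] | assumption | by apply: expf_neq0 | by apply/eqP => ?; lra].

Lemma natr_eq {m n : nat} : m = n -> m%:R = n%:R :> rat.
Proof. by move=> ->. Qed.

Definition ecb (k : nat) : rat := 'C(2 * k, k)%:R / 4%:R ^+ k.

Lemma ecb0 : ecb 0 = 1.
Proof. by rewrite /ecb bin0 expr0 divr1. Qed.

Lemma central_binS k :
  ('C(2 * k.+1, k.+1) * k.+1 = 2 * (2 * k + 1) * 'C(2 * k, k))%N.
Proof.
have h1 := mul_bin_diag (2 * k).+2 k.
have h2 := mul_bin_down (2 * k).+1 k.
rewrite /= in h1 h2.
have -> : (2 * k.+1 = (2 * k).+2)%N by lia.
have e : ((2 * k).+1 - k = k.+1)%N by lia.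
rewrite e in h2.
rewrite mulnC -h1 addn1 -mulnA h2; lia.
Qed.

Lemma ecbS k : ecb k.+1 = ecb k * (2 * k%:R + 1) / (2 * (k%:R + 1)).
Proof.
have h := natr_eq (central_binS k).
have k0 := ler0n rat k.
have e : 'C(2 * k.+1, k.+1)%:R = 2 * (2 * k%:R + 1) * 'C(2 * k, k)%:R / (k%:R + 1) :> rat.
  apply: (canRL (mulfK _)); first by nonzero.
  by move: h; rewrite !natrM natrD natrM -[k.+1%:R]natr1.
rewrite /ecb e exprS; field.
by rewrite expf_neq0 //=; nonzero.
Qed.

Lemma ecb_gt0 k : 0 < ecb k.
Proof.
rewrite /ecb divr_gt0 ?exprn_gt0 // ltr0n bin_gt0; lia.
Qed.

Lemma ecb_neq0 k : ecb k != 0.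
Proof. by rewrite gt_eqF // ecb_gt0. Qed.

(* Later uses feed [bt] functions with a factor [1 / k], whose value at [k = 0]
   is [0]. *)
Definition bt (j : nat) (f : nat -> rat) : rat :=
  \sum_(0 <= k < j.+1) (-1) ^+ k * 'C(j, k)%:R * f k.

Lemma eq_bt j f g : (forall k, (k <= j)%N -> f k = g k) -> bt j f = bt j g.
Proof. by move=> fg; apply: eq_big_nat => k /andP[_ kj]; rewrite fg. Qed.

Lemma bt0 f : bt 0 f = f 0%N.
Proof. by rewrite /bt big_nat1 expr0 bin0 !mul1r. Qed.

Lemma btD j f g : bt j (fun k => f k + g k) = bt j f + bt j g.
Proof. by rewrite /bt -big_split; apply: eq_bigr => k _; rewrite mulrDr. Qed.

Lemma btZ j c f : bt j (fun k => c * f k) = c * bt j f.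
Proof. by rewrite /bt mulr_sumr; apply: eq_bigr => k _; rewrite mulrCA. Qed.

(** Pascal's rule. With [S] the shift of sequences, [bt j f] is the value of [(1 - S)^j f] at
    [0]. *)
Lemma btS j f : bt j.+1 f = bt j (fun k => f k - f k.+1).
Proof.
rewrite /bt big_nat_recl // bin0.
under eq_bigr => k _ do rewrite binS natrD mulrDr mulrDl exprS mulN1r !mulNr.
rewrite big_split /=.
under [in RHS]eq_bigr => k _ do rewrite mulrBr.
rewrite sumrB addrA; congr (_ + _); last by rewrite sumrN.
rewrite big_nat_recr //= bin_small // mulr0n mulr0 mul0r oppr0 addr0.
rewrite [RHS]big_nat_recl // bin0; congr (_ + _).
by apply: eq_bigr => k _; rewrite exprS mulN1r !mulNr.
Qed.

Lemma bt_const j c : bt j.+1 (fun _ => c) = 0.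
Proof. by rewrite btS /bt big1 // => k _; rewrite subrr mulr0. Qed.

(** Since [(j + 1) C(j, k) = (j + 1 - k) C(j + 1, k)], the combination
    [(2j + 3) C(j + 1, k) - 2 (j + 1) C(j, k)] is [(2k + 1) C(j + 1, k)], which cancels the
    denominator. *)
Lemma bt_odd_div j f :
  (2 * j%:R + 3) * bt j.+1 (fun k => f k / (2 * k%:R + 1))
  = 2 * (j%:R + 1) * bt j (fun k => f k / (2 * k%:R + 1)) + bt j.+1 f.
Proof.
rewrite /bt !mulr_sumr [X in _ = _ + X]big_nat_recr //= [LHS]big_nat_recr //=.
rewrite [RHS]addrA; congr (_ + _).
  rewrite -big_split /=; apply: eq_big_nat => k /andP[_ kj].
  have h := natr_eq (mul_bin_down j.+1 k).
  have e : (j%:R + 1) * 'C(j, k)%:R = (j%:R + 1 - k%:R) * 'C(j.+1, k)%:R :> rat.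
    by move: h; rewrite !natrM natrB ?leqW // -natr1.
  have k0 := ler0n rat k.
  have -> : 2 * (j%:R + 1) * ((-1) ^+ k * 'C(j, k)%:R * (f k / (2 * k%:R + 1)))
    = 2 * (-1) ^+ k * ((j%:R + 1) * 'C(j, k)%:R) * (f k / (2 * k%:R + 1)) :> rat by ring.
  by rewrite e; field; nonzero.
have k0 := ler0n rat j.
by rewrite binn -natr1; field; nonzero.
Qed.

(** This is the integral of [(1 - x^2)^j] over [[0, 1]]; for constant [f] the recurrence
    [bt_odd_div] is homogeneous. *)
Lemma bt_odd_inv j :
  bt j (fun k => 1 / (2 * k%:R + 1)) = 1 / ((2 * j%:R + 1) * ecb j).
Proof.
elim: j => [|j IH]; first by rewrite bt0 ecb0 mulr0.
have := bt_odd_div j (fun=> 1); rewrite IH bt_const addr0 ecbS -natr1 => h.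
have j0 := ler0n rat j; have e0 := ecb_neq0 j.
apply: (mulfI (x := 2 * j%:R + 3)); first by nonzero.
rewrite h; field.
by nonzero.
Qed.

(** * Harmonic sums and their alternating binomial transforms *)

Definition harm (k : nat) : rat := \sum_(0 <= l < k) (l%:R + 1)^-1.
Definition oddharm (k : nat) : rat := \sum_(0 <= l < k) (2 * l%:R + 1)^-1.
(** The second elementary symmetric function of [1, 1/3, ..., 1/(2k - 1)]; [oddharm] is the
    first. *)
Definition oddharm2 (k : nat) : rat :=
  \sum_(0 <= l < k) oddharm l / (2 * l%:R + 1).

Lemma harm0 : harm 0 = 0. Proof. by rewrite /harm big_geq. Qed.
Lemma oddharm0 : oddharm 0 = 0. Proof. by rewrite /oddharm big_geq. Qed.
Lemma oddharm20 : oddharm2 0 = 0. Proof. by rewrite /oddharm2 big_geq. Qed.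
Lemma harmS k : harm k.+1 = harm k + (k%:R + 1)^-1.
Proof. by rewrite /harm big_nat_recr. Qed.
Lemma oddharmS k : oddharm k.+1 = oddharm k + (2 * k%:R + 1)^-1.
Proof. by rewrite /oddharm big_nat_recr. Qed.
Lemma oddharm2S k : oddharm2 k.+1 = oddharm2 k + oddharm k / (2 * k%:R + 1).
Proof. by rewrite /oddharm2 big_nat_recr. Qed.

Lemma bt_oddharm j : bt j.+1 oddharm = - (1 / (2 * (j%:R + 1) * ecb j.+1)).
Proof.
rewrite btS.
rewrite (@eq_bt _ _ (fun k => -1 * (1 / (2 * k%:R + 1)))); last first.
  by move=> k _; rewrite oddharmS; ring.
rewrite btZ bt_odd_inv ecbS.
have j0 := ler0n rat j; have e0 := ecb_neq0 j.
by field; nonzero.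
Qed.

(** Multiplied by [(2j + 1) ecb j], the transform drops by [1 / (2 (j + 1))] at each step of
    [bt_odd_div], and these increments add up to [harm j / 2]. *)
Lemma bt_oddharm_div j :
  bt j (fun k => oddharm k / (2 * k%:R + 1))
  = - (harm j / (2 * (2 * j%:R + 1) * ecb j)).
Proof.
elim: j => [|j IH]; first by rewrite bt0 oddharm0 harm0 !mul0r oppr0.
have := bt_odd_div j oddharm; rewrite IH bt_oddharm harmS ecbS -natr1 => h.
have j0 := ler0n rat j; have e0 := ecb_neq0 j.
apply: (mulfI (x := 2 * j%:R + 3)); first by nonzero.
by rewrite h; field; nonzero.
Qed.

Lemma bt_oddharm2 j :
  bt j.+1 oddharm2 = harm j / (4 * (j%:R + 1) * ecb j.+1).
Proof.
rewrite btS.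
rewrite (@eq_bt _ _ (fun k => -1 * (oddharm k / (2 * k%:R + 1)))); last first.
  by move=> k _; rewrite oddharm2S; ring.
rewrite btZ bt_oddharm_div ecbS.
have j0 := ler0n rat j; have e0 := ecb_neq0 j.
by field; nonzero.
Qed.

(** By [C(n + 1, k) - C(n, k) = k C(n + 1, k) / (n + 1)], raising [n] by one adds
    [bt n.+1 f / (n + 1)]. The condition on [f 0] covers [k = 0], where [f k / k] is [0]. *)
Lemma bt_div n f : f 0%N = 0 ->
  bt n (fun k => f k / k%:R) = \sum_(0 <= j < n) bt j.+1 f / (j%:R + 1).
Proof.
move=> f0; elim: n => [|n IH]; first by rewrite bt0 big_geq // invr0 mulr0.
rewrite big_nat_recr //= -IH /bt.
rewrite [LHS]big_nat_recl // [X in _ = X + _]big_nat_recl // invr0 !mulr0 !add0r.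
rewrite [X in _ = _ + X / _]big_nat_recl // f0 mulr0 add0r mulr_suml.
have -> : \sum_(0 <= k < n) (-1) ^+ k.+1 * 'C(n, k.+1)%:R * (f k.+1 / k.+1%:R)
  = \sum_(0 <= k < n.+1) (-1) ^+ k.+1 * 'C(n, k.+1)%:R * (f k.+1 / k.+1%:R) :> rat.
  by rewrite [RHS]big_nat_recr //= bin_small // mulr0 mul0r addr0.
rewrite -big_split /=; apply: eq_bigr => k _.
have h := natr_eq (mul_bin_diag n.+1 k).
have n0 := ler0n rat n; have k0 := ler0n rat k.
have e : 'C(n, k)%:R = (k%:R + 1) * 'C(n.+1, k.+1)%:R / (n%:R + 1) :> rat.
  apply: (canRL (mulfK _)); first by nonzero.
  by rewrite mulrC; move: h; rewrite !natrM !natr1.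
have -> : 'C(n, k.+1)%:R = 'C(n.+1, k.+1)%:R - 'C(n, k)%:R :> rat.
  by rewrite binS natrD addrK.
by rewrite e -natr1; field; nonzero.
Qed.

Lemma bt_inv n : bt n (fun k => 1 / k%:R) = - harm n.
Proof.
(* The numerator [1] is replaced by one that vanishes at [0], as [bt_div] requires; the values agree
   because [1 / 0 = 0]. *)
rewrite (@eq_bt _ _ (fun k => (k != 0)%:R / k%:R)); last first.
  by case=> // _; rewrite invr0 !mulr0.
rewrite bt_div // /harm -sumrN; apply: eq_bigr => j _.
rewrite -mulN1r; congr (_ * _).
rewrite btS /bt big_nat_recl // expr0 bin0 !mul1r big1 ?addr0 ?sub0r // => k _.
by rewrite subrr mulr0.
Qed.

Definition invecb2 (n : nat) : rat :=
  \sum_(0 <= j < n) 1 / ((j%:R + 1) ^+ 2 * ecb j.+1).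

Lemma bt_oddharm_k n : bt n (fun k => oddharm k / k%:R) = - (invecb2 n / 2).
Proof.
rewrite bt_div ?oddharm0 // /invecb2 mulr_suml -sumrN; apply: eq_bigr => j _.
rewrite bt_oddharm; have j0 := ler0n rat j; have e0 := ecb_neq0 j.+1.
by field; nonzero.
Qed.

(** [bt_div] is applied twice; exchanging the two summations leaves the weight [harm n - harm j],
    the sum of [1 / i] over [j < i <= n]. *)
Lemma bt_oddharm_k2 n :
  bt n (fun k => oddharm k / k%:R / k%:R)
  = - (\sum_(0 <= j < n) (harm n - harm j) / ((j%:R + 1) ^+ 2 * ecb j.+1)) / 2.
Proof.
rewrite bt_div ?oddharm0 ?mul0r //.
elim: n => [|n IH]; first by rewrite !big_geq // oppr0 mul0r.
rewrite big_nat_recr //= IH bt_oddharm_k [in RHS]big_nat_recr //= harmS.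
have n0 := ler0n rat n; have e0 := ecb_neq0 n.+1.
have -> : \sum_(0 <= j < n) (harm n + (n%:R + 1)^-1 - harm j) / ((j%:R + 1) ^+ 2 * ecb j.+1)
  = \sum_(0 <= j < n) (harm n - harm j) / ((j%:R + 1) ^+ 2 * ecb j.+1)
    + invecb2 n / (n%:R + 1).
  rewrite /invecb2 mulr_suml -big_split; apply: eq_bigr => j _ /=; ring.
rewrite /invecb2 big_nat_recr //= -/(invecb2 n).
by field; nonzero.
Qed.

Lemma bt_oddharm2_k n :
  bt n (fun k => oddharm2 k / k%:R)
  = (\sum_(0 <= j < n) harm j / ((j%:R + 1) ^+ 2 * ecb j.+1)) / 4.
Proof.
rewrite bt_div ?oddharm20 // mulr_suml; apply: eq_bigr => j _.
rewrite bt_oddharm2; have j0 := ler0n rat j; have e0 := ecb_neq0 j.+1.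
by field; nonzero.
Qed.

(** In terms of the shift [S], this is [(1 - S/2)^n = 2^(-n) (1 + (1 - S))^n], expanded in powers of
    [1 - S]. *)
Lemma bt_half n f :
  bt n (fun k => f k / 2%:R ^+ k)
  = (\sum_(0 <= j < n.+1) 'C(n, j)%:R * bt j f) / 2%:R ^+ n.
Proof.
elim: n f => [|n IH] f; first by rewrite big_nat1 !bt0 bin0 mul1r.
rewrite btS (@eq_bt _ _ (fun k => (f k - f k.+1 / 2) / 2%:R ^+ k)); last first.
  by move=> k _; rewrite exprS; field; rewrite expf_neq0.
rewrite IH.
have -> : \sum_(0 <= j < n.+2) 'C(n.+1, j)%:R * bt j f
  = \sum_(0 <= j < n.+1) 'C(n, j)%:R * (bt j f + bt j.+1 f).
  rewrite big_nat_recl // bin0.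
  under eq_bigr => k _ do rewrite binS natrD mulrDl.
  under [in RHS]eq_bigr => k _ do rewrite mulrDr.
  rewrite !big_split addrA; congr (_ + _).
  rewrite big_nat_recr //= bin_small // mul0r addr0.
  by rewrite [RHS]big_nat_recl // bin0.
rewrite exprS !mulr_suml; apply: eq_bigr => j _.
have -> : bt j.+1 f = bt j f - bt j (fun k => f k.+1).
  by rewrite btS btD -[X in _ = _ - X]mul1r -mulNr -btZ; congr (_ + _); apply: eq_bt => k _; rewrite mulN1r.
have -> : bt j (fun k => f k - f k.+1 / 2) = bt j f - bt j (fun k => f k.+1) / 2.
  rewrite btD; congr (_ + _).
  by rewrite mulrC -mulNr -btZ; apply: eq_bt => k _; ring.
by field; rewrite expf_neq0.
Qed.

(** Pascal's rule expresses the sum [s] for [n + 1] through the sum for [n] and half of [s] without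
    its last term. The boundary terms cancel because [C(2n + 2, n + 1) = 2 C(2n + 1, n + 1)]. *)
Lemma bin_half_sum n :
  \sum_(0 <= k < n.+1) 'C(n + k, k)%:R / 2%:R ^+ k = 2%:R ^+ n :> rat.
Proof.
elim: n => [|n IH]; first by rewrite big_nat1 bin0 expr0 divr1.
set s := LHS.
have h2 : s = \sum_(0 <= k < n.+1) 'C(n.+1 + k, k)%:R / 2%:R ^+ k
    + 'C(n.+1 + n.+1, n.+1)%:R / 2%:R ^+ n.+1.
  by rewrite /s big_nat_recr.
have h1 : s = 2%:R ^+ n + 'C((n + n).+1, n.+1)%:R / 2%:R ^+ n.+1
    + (\sum_(0 <= k < n.+1) 'C(n.+1 + k, k)%:R / 2%:R ^+ k) / 2.
  rewrite -IH -addnS -(big_nat_recr n.+1 0 (fun k => 'C(n + k, k)%:R / 2%:R ^+ k)) //=.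
  rewrite /s mulr_suml [LHS]big_nat_recl //.
  rewrite [X in _ = X + _](@big_nat_recl _ _ _ n.+1 0) // !bin0 -[RHS]addrA.
  congr (_ + _); rewrite -big_split /=; apply: eq_bigr => k _.
  rewrite addSn binS natrD mulrDl; congr (_ + _).
  by rewrite addnS exprS -addSn; field; nonzero.
have e : s = 2%:R ^+ n + 'C((n + n).+1, n.+1)%:R / 2%:R ^+ n.+1
  + (s - 'C((n.+1 + n.+1), n.+1)%:R / 2%:R ^+ n.+1) / 2.
  by rewrite {2}h2 addrK.
have e2 : 'C(n.+1 + n.+1, n.+1)%:R = 2 * 'C((n + n).+1, n.+1)%:R :> rat.
  rewrite addSn addnS binS -[X in (_ + X)%N]bin_sub; last by lia.
  have -> : ((n + n).+1 - n = n.+1)%N by lia.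
  by rewrite natrD; ring.
rewrite e2 in e; rewrite exprS.
set t := _ / 2%:R ^+ n.+1 in e.
have {}e : s = 2 ^+ n + t + (s - 2 * t) / 2 by rewrite {1}e /t mulrA.
by clear -e; lra.
Qed.

(** * Diagonal sums and sums of reciprocal binomials *)

Lemma sum_binom_diag n m :
  (\sum_(0 <= k < m.+1) 'C(n + k, k) = 'C((n + m).+1, m))%N.
Proof.
elim: m => [|m IH]; first by rewrite big_nat1 !bin0.
by rewrite big_nat_recr //= IH [in RHS]addnS [RHS]binS addnC addnS.
Qed.

Definition csum (n : nat) : rat := \sum_(1 <= k < n.+1) 'C(2 * k, k)%:R / k%:R.

(** Passing from [n] to [n + 1] changes the [k]-th term by [C(n + k, k - 1) / k = C(n + k, k) / (n +
    1)], and [sum_binom_diag] sums these increments. *)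
Lemma csum_diag n :
  \sum_(1 <= k < n.+1) 'C(n + k, k)%:R / k%:R = 3 / 2 * csum n - harm n.
Proof.
elim: n => [|n IH]; first by rewrite /csum !big_geq // harm0 mulr0 subr0.
rewrite /csum [in RHS]big_nat_recr //= -/(csum n) harmS.
have n0 := ler0n rat n.
have e : \sum_(1 <= k < n.+2) 'C(n.+1 + k, k)%:R / k%:R
  = \sum_(1 <= k < n.+2) ('C(n + k, k)%:R / k%:R + 'C(n + k, k)%:R / (n%:R + 1)) :> rat.
  apply: eq_big_nat => -[//|k] _; rewrite addSn binS natrD mulrDl; congr (_ + _).
  have := natr_eq (mul_bin_left (n + k.+1) k).
  have -> : (n + k.+1 - k = n.+1)%N by lia.
  have k0 := ler0n rat k.
  rewrite !natrM -(natr1 n) -(natr1 k) => h.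
  apply: (canLR (mulfK _)); first by nonzero.
  rewrite mulrAC; apply: (canRL (mulfK _)); first by nonzero.
  by rewrite mulrC -h mulrC.
rewrite e big_split big_nat_recr //= IH -mulr_suml.
have h1 := sum_binom_diag n n.+1.
rewrite big_ltn // bin0 in h1.
have h2 : 'C((n + n.+1).+1, n.+1)%:R = 2 * 'C(n + n.+1, n.+1)%:R :> rat.
  rewrite binS natrD -[in X in _ + X](@bin_sub (n + n.+1) n); last by lia.
  have -> : (n + n.+1 - n = n.+1)%N by lia.
  by ring.
have := natr_eq h1; rewrite natrD h2 natr_sum => h3.
have -> : (2 * n.+1 = (n + n.+1).+1)%N by lia.
rewrite h2 -(natr1 n).
have -> : \sum_(1 <= i < n.+2) 'C(n + i, i)%:R = 2 * 'C(n + n.+1, n.+1)%:R - 1 :> rat by lra.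
by field; nonzero.
Qed.

(** The Beta value [B(k, n - k + 1)]; in factorial form its ratios in [n] and in [k] are
    immediate. *)
Definition betaf (n k : nat) : rat := (k.-1`! * (n - k)`!)%:R / n`!%:R.

Lemma fact_neq0 n : n`!%:R != 0 :> rat.
Proof. by rewrite pnatr_eq0 -lt0n fact_gt0. Qed.

Lemma betafE n k : (0 < k <= n)%N -> betaf n k = 1 / (k%:R * 'C(n, k)%:R).
Proof.
case: k => // k /= kn; rewrite /betaf -(bin_fact kn) factS !natrM.
have k0 : k.+1%:R != 0 :> rat by rewrite pnatr_eq0.
have c0 : 'C(n, k.+1)%:R != 0 :> rat by rewrite pnatr_eq0 -lt0n bin_gt0.
have k1 := ler0n rat k.
by field; rewrite c0 !fact_neq0 /=; nonzero.
Qed.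

Lemma betaf_prev n k : (0 < k <= n)%N ->
  betaf n k = betaf n.+1 k * (n%:R + 1) / (n%:R + 1 - k%:R).
Proof.
case/andP => k1 kn; rewrite /betaf subSn // !factS !natrM -natr1 natrB // natr1.
have : (k%:R <= n%:R :> rat) by rewrite ler_nat.
have n0 := ler0n rat n => h.
field; rewrite fact_neq0 /=; nonzero.
Qed.

Lemma betaf_next n k : (0 < k <= n)%N ->
  betaf n.+1 k.+1 = betaf n.+1 k * k%:R / (n%:R + 1 - k%:R).
Proof.
case: k => // k kn; rewrite /betaf subSS subSn //= !factS !natrM -![(n - _).+1%:R]natr1 natrB //.
have : (k.+1%:R <= n%:R :> rat) by rewrite ler_nat.
have n0 := ler0n rat n => h.
rewrite -(natr1 k) in h *; field; rewrite fact_neq0 /=; nonzero.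
Qed.

Lemma betaf1 n : betaf n.+1 1 = 1 / (n%:R + 1).
Proof.
rewrite /betaf fact0 mul1n subSS subn0 factS natrM -natr1.
have n0 := ler0n rat n; field; rewrite fact_neq0 /=; nonzero.
Qed.

Lemma betaf_last n : betaf n.+1 n.+1 = 1 / (n%:R + 1).
Proof.
rewrite /betaf subnn fact0 muln1 factS natrM -natr1 /=.
have n0 := ler0n rat n; field; rewrite fact_neq0 /=; nonzero.
Qed.

Lemma alt_betaf_sum n :
  \sum_(1 <= k < n.+1) (-1) ^+ k * betaf n k / k%:R
  = \sum_(1 <= j < n.+1) (1 + 2 * (-1) ^+ j) / j%:R ^+ 2.
Proof.
elim: n => [|n IH]; first by rewrite !big_geq.
rewrite [RHS]big_nat_recr //= -IH [LHS]big_nat_recr //= betaf_last.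
(* The telescoping certificate: the [k]-th summands for [n + 1] and for [n] differ by
   [G (k + 1) - G k]. *)
pose G k : rat := (-1) ^+ k * betaf n.+1 k / (n%:R + 1).
have n0 := ler0n rat n.
have e : \sum_(1 <= k < n.+1) (-1) ^+ k * betaf n.+1 k / k%:R
  = \sum_(1 <= k < n.+1) (-1) ^+ k * betaf n k / k%:R + (G n.+1 - G 1%N).
  rewrite -telescope_sumr // -big_split; apply: eq_big_nat => k kn.
  rewrite /= /G (betaf_next _ _ kn) (betaf_prev _ _ kn) exprS.
  have [k1 k2] : (1 <= k%:R :> rat) /\ (k%:R <= n%:R :> rat) by move/andP: kn => [? ?]; rewrite ler1n ler_nat.
  by field; nonzero.
rewrite e /G betaf1 betaf_last expr1 -(natr1 n).
by field; nonzero.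
Qed.

(* Staver's identity; the certificate [G] comes from Zeilberger's algorithm. *)
Lemma staver n :
  (2 * n%:R + 1) * 'C(2 * n, n)%:R * \sum_(1 <= k < n.+1) betaf n k ^+ 2
  = 3 * csum n.
Proof.
elim: n => [|n IH]; first by rewrite /csum !big_geq // !mulr0.
pose N : rat := n%:R + 1.
pose G k : rat := (k%:R - (3 * N + 2) / 2) * betaf n.+1 k ^+ 2.
have n0 := ler0n rat n.
have e : (2 * N + 1) * \sum_(1 <= k < n.+1) betaf n.+1 k ^+ 2
  = N / 2 * \sum_(1 <= k < n.+1) betaf n k ^+ 2 + (G n.+1 - G 1%N).
  rewrite -telescope_sumr // !mulr_sumr -big_split; apply: eq_big_nat => k kn /=.
  rewrite /= /G (betaf_next _ _ kn) (betaf_prev _ _ kn) -(natr1 k) /N.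
  have [k1 k2] : (1 <= k%:R :> rat) /\ (k%:R <= n%:R :> rat) by move/andP: kn => [? ?]; rewrite ler1n ler_nat.
  by field; nonzero.
rewrite /csum [in RHS]big_nat_recr //= -/(csum n) mulrDr -IH [in LHS]big_nat_recr //=.
have h := natr_eq (central_binS n); rewrite !natrM natrD natrM -[n.+1%:R]natr1 in h.
have {h} -> : 'C(2 * n.+1, n.+1)%:R = 2 * (2 * n%:R + 1) * 'C(2 * n, n)%:R / (n%:R + 1) :> rat.
  by apply: (canRL (mulfK _)); first nonzero.
have {}e : \sum_(1 <= k < n.+1) betaf n.+1 k ^+ 2
  = (N / 2 * \sum_(1 <= k < n.+1) betaf n k ^+ 2 + (G n.+1 - G 1%N)) / (2 * N + 1).
  by apply: (canRL (mulfK _)); [rewrite /N; nonzero | rewrite mulrC].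
rewrite e /G /N betaf1 betaf_last -(natr1 n).
by field; nonzero.
Qed.

(** Telescopes, since [2 (k + 1) ecb (k + 1) = (2k + 1) ecb k] and [(2k + 1)^2 - 4 k^2 = 4k + 1]. *)
Lemma sum_lin_ecb2 m n : (m <= n)%N ->
  \sum_(m <= k < n) (4 * k%:R + 1) * ecb k ^+ 2
  = 4 * n%:R ^+ 2 * ecb n ^+ 2 - 4 * m%:R ^+ 2 * ecb m ^+ 2.
Proof.
move=> mn; rewrite -(telescope_sumr (fun k => 4 * k%:R ^+ 2 * ecb k ^+ 2)) //.
apply: eq_bigr => k _; rewrite ecbS -(natr1 k); have k0 := ler0n rat k.
by field; nonzero.
Qed.

Definition ecb_conv m := \sum_(0 <= k < m.+1) ecb k / (2 * m%:R + 1 - 2 * k%:R).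

(** The summand identity behind [ecb_convS], with [x = m], [y = k] and [z = ecb k]; the bracket is
    the increment in [k] of [2 k ecb k / (2m + 3 - 2k)]. *)
Lemma ecb_conv_step (x y z : rat) : 0 <= y -> y <= x ->
  (2 * x + 3) * (z / (2 * (x + 1) + 1 - 2 * y))
  = 2 * (x + 1) * (z / (2 * x + 1 - 2 * y))
  - (2 * (y + 1) * (z * (2 * y + 1) / (2 * (y + 1)))
       / (2 * (x + 1) + 1 - 2 * (y + 1))
     - 2 * y * z / (2 * (x + 1) + 1 - 2 * y)).
Proof. by move=> y0 yx; field; nonzero. Qed.

Lemma ecb_convS m :
  (2 * m%:R + 3) * ecb_conv m.+1 = 2 * (m%:R + 1) * ecb_conv m + ecb m.+1.
Proof.
have m0 := ler0n rat m.
have term k : k%:R <= m%:R :> rat ->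
  (2 * m%:R + 3) * (ecb k / (2 * m.+1%:R + 1 - 2 * k%:R))
  = 2 * (m%:R + 1) * (ecb k / (2 * m%:R + 1 - 2 * k%:R))
  - (2 * k.+1%:R * ecb k.+1 / (2 * (m%:R + 1) + 1 - 2 * k.+1%:R)
     - 2 * k%:R * ecb k / (2 * (m%:R + 1) + 1 - 2 * k%:R)).
  move=> h; rewrite ecbS -(natr1 m) -(natr1 k); have k0 := ler0n rat k.
  exact: ecb_conv_step.
pose g k := 2 * k%:R * ecb k / (2 * (m%:R + 1) + 1 - 2 * k%:R).
rewrite /ecb_conv big_nat_recr //= mulrDr.
have -> : (2 * m%:R + 3) * \sum_(0 <= k < m.+1) ecb k / (2 * m.+1%:R + 1 - 2 * k%:R)
  = 2 * (m%:R + 1) * \sum_(0 <= k < m.+1) ecb k / (2 * m%:R + 1 - 2 * k%:R)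
    - (g m.+1 - g 0%N).
  rewrite -telescope_sumr // !mulr_sumr -sumrB; apply: eq_big_nat => k /= km.
  by rewrite term // ler_nat.
have -> : g 0%N = 0 by rewrite /g mulr0 !mul0r.
by rewrite /g -(natr1 m); clear g term; field; nonzero.
Qed.

(** Multiplying [ecb_convS] by [ecb n.+1] and using [2 (n + 1) ecb n.+1 = (2n + 1) ecb n] shows that
    the right side grows by [ecb n.+1 ^+ 2]. *)
Lemma sum_ecb2 n :
  \sum_(0 <= k < n.+1) ecb k ^+ 2
  = (2 * n%:R + 1) * ecb n
    * \sum_(0 <= k < n.+1) ecb k / (2 * n%:R + 1 - 2 * k%:R).
Proof.
rewrite -/(ecb_conv n).
elim: n => [|n IH].
  by rewrite /ecb_conv !big_nat1 ecb0; field.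
rewrite big_nat_recr //= IH ecbS -(natr1 n); have n0 := ler0n rat n.
have -> : (2 * (n%:R + 1) + 1) * (ecb n * (2 * n%:R + 1) / (2 * (n%:R + 1))) * ecb_conv n.+1
  = (ecb n * (2 * n%:R + 1) / (2 * (n%:R + 1))) * ((2 * n%:R + 3) * ecb_conv n.+1) by ring.
by rewrite ecb_convS ecbS; field; nonzero.
Qed.

(** * Congruences between p-integral rationals *)

(** Rationals with denominator prime to [p], as a predicate that is made a subring below, so that
    the generic [rpred] lemmas apply. *)
Definition pint_pred (p : nat) : pred rat := fun x => coprime p `|denq x|.

Definition pint (p : nat) := [qualify a x | pint_pred p x].

Lemma pintE p x : (x \is a pint p) = coprime p `|denq x|.
Proof. by []. Qed.

(** Any denominator prime to [p] is allowed here, reduced or not, which makes closure under the ring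
    operations easy. *)
Lemma pintP p x :
  reflect (exists2 d : nat, (0 < d)%N && coprime p d & x * d%:R \is a Num.int)
          (x \is a pint p).
Proof.
rewrite pintE; apply: (iffP idP) => [cop | [d /andP[d0 cop] /intrP[m xd]]].
  exists `|denq x|%N; first by rewrite absz_gt0 denq_neq0.
  by rewrite -[_%:R]/((Posz `|denq x|)%:~R) absz_denq -numqE rpred_int.
have e : numq x * d%:Z = m * denq x.
  apply: (@intr_inj rat); rewrite !rmorphM /= numqE mulrAC [x * _]xd.
  by [].
suff : (`|denq x| %| d)%N by move/coprime_dvdr; apply.
have : (`|denq x| %| `|numq x| * d)%N.
  by rewrite -[d]absz_nat -abszM e abszM dvdn_mull.
by rewrite Gauss_dvdr // coprime_sym coprime_num_den.
Qed.

Lemma pint_subring p : subring_closed (pint p).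
Proof.
split=> [|x y|x y]; first by rewrite pintE coprimen1.
- move=> /pintP[d /andP[d0 dp] dx] /pintP[e /andP[e0 ep] ey]; apply/pintP.
  exists (d * e)%N; first by rewrite muln_gt0 d0 e0 coprimeMr dp ep.
  rewrite natrM mulrBl mulrA [d%:R * _]mulrC mulrA.
  by rewrite rpredB // rpredM // rpred_nat.
- move=> /pintP[d /andP[d0 dp] dx] /pintP[e /andP[e0 ep] ey]; apply/pintP.
  exists (d * e)%N; first by rewrite muln_gt0 d0 e0 coprimeMr dp ep.
  by rewrite natrM mulrACA rpredM.
Qed.

HB.instance Definition _ p :=
  GRing.isSubringClosed.Build rat (pint_pred p) (pint_subring p).

(** Decomposes a polynomial expression into atoms whose integrality is in the context; [constr_eq]
    makes the search for them syntactic. *)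
Ltac pint_split :=
  repeat match goal with
  | H : is_true (?x \in _) |- is_true (?y \in _) => constr_eq x y; exact H
  | |- is_true (_ + _ \in _) => apply: rpredD
  | |- is_true (- _ \in _) => rewrite rpredN
  | |- is_true (_ * _ \in _) => apply: rpredM
  | |- is_true (_ ^+ _ \in _) => apply: rpredX
  | |- is_true (_%:R \in _) => exact: rpred_nat
  | |- is_true (1 \in _) => exact: rpred1
  end.

Lemma pint_int p (z : int) : z%:~R \is a pint p.
Proof. exact: rpred_int. Qed.

Lemma pintV p k : coprime p k -> k%:R^-1 \is a pint p.
Proof.
case: k => [|k] cop; first by rewrite invr0 rpred0.
apply/pintP; exists k.+1; first by rewrite cop.
by rewrite mulVf ?rpred1 // pnatr_eq0.
Qed.

Definition cong (p m : nat) (a b : rat) : Prop :=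
  (a - b) / p%:R ^+ m \is a pint p.

(** With its converse [congE], this trades a congruence for an equation with an explicit integral
    remainder, so that congruences are combined by [ring] and [field]. *)
Lemma cong_of p m a b c : (0 < p)%N ->
  c \is a pint p -> a = b + p%:R ^+ m * c -> cong p m a b.
Proof.
move=> p0 cp ->; rewrite /cong addrC addKr mulrC mulKf //.
by rewrite expf_neq0 // pnatr_eq0 -lt0n.
Qed.

Lemma congE p m a b : (0 < p)%N -> cong p m a b ->
  exists2 c, c \is a pint p & a = b + p%:R ^+ m * c.
Proof.
move=> p0 ab; exists ((a - b) / p%:R ^+ m) => //.
by rewrite mulrC divfK ?subrKC // expf_neq0 // pnatr_eq0 -lt0n.
Qed.

Lemma cong_refl p m a : cong p m a a.
Proof. by rewrite /cong subrr mul0r rpred0. Qed.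

Lemma cong_eq p m a b : a = b -> cong p m a b.
Proof. by move=> ->; exact: cong_refl. Qed.

Lemma cong_sym p m a b : cong p m a b -> cong p m b a.
Proof. by rewrite /cong => ab; rewrite -opprB mulNr rpredN. Qed.

Lemma cong_trans p m b a c : cong p m a b -> cong p m b c -> cong p m a c.
Proof.
rewrite /cong => ab bc.
by rewrite -(subrKA b) mulrDl rpredD.
Qed.

Lemma congD p m a b a' b' :
  cong p m a a' -> cong p m b b' -> cong p m (a + b) (a' + b').
Proof. by rewrite /cong => aa bb; rewrite opprD addrACA mulrDl rpredD. Qed.

Lemma congN p m a b : cong p m a b -> cong p m (- a) (- b).
Proof. by rewrite /cong => ab; rewrite -opprD mulNr rpredN. Qed.

Lemma congB p m a b a' b' :
  cong p m a a' -> cong p m b b' -> cong p m (a - b) (a' - b').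
Proof. by move=> aa bb; apply: congD => //; apply: congN. Qed.

Lemma congMl p m c a b :
  c \is a pint p -> cong p m a b -> cong p m (c * a) (c * b).
Proof. by rewrite /cong => cp ab; rewrite -mulrBr -mulrA rpredM. Qed.

Lemma congMr p m c a b :
  c \is a pint p -> cong p m a b -> cong p m (a * c) (b * c).
Proof. by rewrite ![_ * c]mulrC; exact: congMl. Qed.

Lemma congM p m a b a' b' : a' \is a pint p -> b \is a pint p ->
  cong p m a a' -> cong p m b b' -> cong p m (a * b) (a' * b').
Proof.
move=> pa pb aa bb.
by apply: (@cong_trans _ _ (a' * b)); [exact: congMr | exact: congMl].
Qed.

Lemma cong_sum p m i j (f g : nat -> rat) :
  (forall k, (i <= k < j)%N -> cong p m (f k) (g k)) ->
  cong p m (\sum_(i <= k < j) f k) (\sum_(i <= k < j) g k).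
Proof.
move=> fg; rewrite big_nat_cond [X in cong _ _ _ X]big_nat_cond.
elim/big_ind2: _ => [|????|k]; [exact: cong_refl | exact: congD |].
by rewrite andbT; exact: fg.
Qed.

Lemma cong_scale p m r a b : (0 < p)%N -> cong p m a b ->
  cong p (r + m) (p%:R ^+ r * a) (p%:R ^+ r * b).
Proof.
move=> p0 /(congE _ _ _ _ p0)[c cp ->]; apply: (@cong_of _ _ _ _ c) => //.
by rewrite exprD mulrDr mulrA.
Qed.

Lemma pint_sum p i j (f : nat -> rat) :
  (forall k, (i <= k < j)%N -> f k \is a pint p) ->
  \sum_(i <= k < j) f k \is a pint p.
Proof.
move=> fp; rewrite big_nat_cond; apply: rpred_sum => k; rewrite andbT; exact: fp.
Qed.

(** * Expansions in p = 2n + 1 *)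

Local Notation pp n := (2 * n).+1.

Lemma pp_natr n : (pp n)%:R = 2 * n%:R + 1 :> rat.
Proof. by rewrite -natr1 natrM. Qed.

Lemma pint_inv n k : prime (pp n) -> (0 < k < pp n)%N ->
  k%:R^-1 \is a pint (pp n).
Proof.
move=> pr /andP[k0 kp]; apply: pintV; rewrite prime_coprime //.
by apply/negP => /(dvdn_leq k0); rewrite leqNgt kp.
Qed.

Lemma pint_invS n k : prime (pp n) -> (k < n)%N ->
  (k%:R + 1)^-1 \is a pint (pp n).
Proof. by move=> pr kn; rewrite natr1 pint_inv //; lia. Qed.

Lemma pint_inv_odd n k : prime (pp n) -> (k < n)%N ->
  (2 * k%:R + 1)^-1 \is a pint (pp n).
Proof. by move=> pr kn; rewrite -pp_natr pint_inv //; lia. Qed.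

Lemma pint_inv2 n : prime (pp n) -> 2%:R^-1 \is a pint (pp n).
Proof. by case: n => // n pr; rewrite pint_inv //; lia. Qed.

Lemma pint_inv_exp2 n k : prime (pp n) -> (2%:R ^+ k)^-1 \is a pint (pp n).
Proof. by move=> pr; rewrite -exprVn rpredX // pint_inv2. Qed.

Lemma pint_inv4 n : prime (pp n) -> 4%:R^-1 \is a pint (pp n).
Proof. by move=> pr; rewrite -[4%N]/(2 ^ 2)%N natrX pint_inv_exp2. Qed.

Lemma pint_ecb n k : prime (pp n) -> ecb k \is a pint (pp n).
Proof.
by move=> pr; rewrite /ecb rpredM ?rpred_nat // -exprVn rpredX // pint_inv4.
Qed.

(** For [k <= n] the odd factors [1, 3, ..., 2k - 1] in the numerator of [ecb k] are smaller than
    [p]. *)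
Lemma pint_ecbV n k : prime (pp n) -> (k <= n)%N -> (ecb k)^-1 \is a pint (pp n).
Proof.
move=> pr; elim: k => [|k IH] kn; first by rewrite ecb0 invr1 rpred1.
have -> : (ecb k.+1)^-1 = (k.+1%:R *+ 2) * ((ecb k)^-1 / (2 * k%:R + 1)).
  have k0 := ler0n rat k; have e0 := ecb_neq0 k.
  by rewrite ecbS -(natr1 k); field; nonzero.
apply: rpredM; first by rewrite rpredMn // rpred_nat.
by rewrite rpredM ?pint_inv_odd // IH // ltnW.
Qed.

Lemma pint_harm n k : prime (pp n) -> (k <= n)%N -> harm k \is a pint (pp n).
Proof.
by move=> pr kn; apply: pint_sum => l lk; apply: pint_invS => //; lia.
Qed.

Lemma pint_oddharm n k : prime (pp n) -> (k <= n)%N ->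
  oddharm k \is a pint (pp n).
Proof.
by move=> pr kn; apply: pint_sum => l lk; apply: pint_inv_odd => //; lia.
Qed.

Lemma pint_oddharm2 n k : prime (pp n) -> (k <= n)%N ->
  oddharm2 k \is a pint (pp n).
Proof.
move=> pr kn; apply: pint_sum => l lk; rewrite rpredM //.
  by apply: pint_oddharm => //; lia.
by apply: pint_inv_odd => //; lia.
Qed.

(** The generating polynomial in [y] of the elementary symmetric functions of
    [1, 1/3, ..., 1/(2k - 1)]; it is used at [y = p] and [y = - p]. *)
Definition shiftprod (y : rat) (k : nat) : rat :=
  \prod_(0 <= l < k) (1 + y / (2 * l%:R + 1)).

Lemma shiftprodS y k :
  shiftprod y k.+1 = shiftprod y k * (1 + y / (2 * k%:R + 1)).
Proof. by rewrite /shiftprod big_nat_recr. Qed.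

Lemma shiftprod0 y : shiftprod y 0 = 1.
Proof. by rewrite /shiftprod big_geq. Qed.

(** The ratio of consecutive binomials is [(n + k + 1) / (k + 1)], and
    [2 (n + k + 1) = (2k + 1) + p]. *)
Lemma bin_add_shiftprod n k : 'C(n + k, k)%:R = ecb k * shiftprod (pp n)%:R k.
Proof.
elim: k => [|k IH]; first by rewrite bin0 ecb0 shiftprod0 mulr1.
have := natr_eq (mul_bin_diag (n + k).+1 k).
rewrite !natrM /= -[(n + k).+1%:R]natr1 natrD -(natr1 k) -addnS IH => h.
have k0 := ler0n rat k.
apply: (mulfI (x := k%:R + 1)); first by nonzero.
rewrite -h ecbS shiftprodS pp_natr.
by field; nonzero.
Qed.

(** The signed ratio is [- (n - k) / (k + 1)], and [- 2 (n - k) = (2k + 1) - p]. *)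
Lemma bin_alt_shiftprod n k : (k <= n)%N ->
  (-1) ^+ k * 'C(n, k)%:R = ecb k * shiftprod (- (pp n)%:R) k.
Proof.
elim: k => [|k IH] kn; first by rewrite bin0 ecb0 shiftprod0 mulr1.
have := natr_eq (mul_bin_left n k).
rewrite !natrM natrB 1?ltnW // -(natr1 k) => h.
have k0 := ler0n rat k.
apply: (mulfI (x := k%:R + 1)); first by nonzero.
rewrite mulrCA h exprS ecbS shiftprodS.
have -> : -1 * (-1) ^+ k * ((n%:R - k%:R) * 'C(n, k)%:R)
  = - (n%:R - k%:R) * ((-1) ^+ k * 'C(n, k)%:R) :> rat by ring.
rewrite IH 1?ltnW // pp_natr.
by field; nonzero.
Qed.

Lemma shiftprod_expand n y k : prime (pp n) -> (k <= n)%N ->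
  y \is a pint (pp n) ->
  exists2 r, r \is a pint (pp n) &
    shiftprod y k = 1 + y * oddharm k + y ^+ 2 * oddharm2 k + y ^+ 3 * r.
Proof.
move=> pr kn yp; elim: k kn => [|k IH] kn.
  exists 0; first exact: rpred0.
  by rewrite shiftprod0 oddharm0 oddharm20 !mulr0 !addr0.
have [r rp e] := IH (ltnW kn).
exists (r + oddharm2 k / (2 * k%:R + 1) + y * r / (2 * k%:R + 1)).
  by rewrite !rpredD ?rpredM // ?pint_oddharm2 ?pint_inv_odd // ltnW.
rewrite shiftprodS e oddharmS oddharm2S; ring.
Qed.

Lemma bin_add_expand n k : prime (pp n) -> (k <= n)%N ->
  exists2 r, r \is a pint (pp n) &
    'C(n + k, k)%:R = ecb k * (1 + (pp n)%:R * oddharm k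
      + (pp n)%:R ^+ 2 * oddharm2 k + (pp n)%:R ^+ 3 * r).
Proof.
move=> pr kn; have [|r rp e] := shiftprod_expand n (pp n)%:R k pr kn.
  exact: rpred_nat.
by exists r; rewrite // bin_add_shiftprod e.
Qed.

Lemma bin_alt_expand n k : prime (pp n) -> (k <= n)%N ->
  exists2 r, r \is a pint (pp n) &
    (-1) ^+ k * 'C(n, k)%:R = ecb k * (1 - (pp n)%:R * oddharm k
      + (pp n)%:R ^+ 2 * oddharm2 k - (pp n)%:R ^+ 3 * r).
Proof.
move=> pr kn; have [|r rp e] := shiftprod_expand n (- (pp n)%:R) k pr kn.
  by rewrite rpredN rpred_nat.
by exists r; rewrite // bin_alt_shiftprod // e; congr (_ * _); ring.
Qed.

Lemma cong_ecb_alt n k : prime (pp n) -> (k <= n)%N ->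
  cong (pp n) 1 (ecb k) ((-1) ^+ k * 'C(n, k)%:R).
Proof.
move=> pr kn; have [r rp ->] := bin_alt_expand n k pr kn.
apply: cong_sym.
apply: (@cong_of _ _ _ _ (ecb k * (- oddharm k + (pp n)%:R * oddharm2 k - (pp n)%:R ^+ 2 * r))) => //.
  by rewrite rpredM ?pint_ecb // !(rpredD, rpredN, rpredM, rpredX, rpred_nat) // ?pint_oddharm ?pint_oddharm2 //.
ring.
Qed.

Lemma coprime_fact p m : prime p -> (m < p)%N -> coprime p m`!.
Proof.
move=> pr; elim: m => [|m IH] mp; first by rewrite fact0 coprimen1.
rewrite factS coprimeMr IH 1?ltnW // andbT prime_coprime //.
by apply/negP => /(dvdn_leq (ltn0Sn m)); rewrite leqNgt mp.
Qed.

Lemma pint_binV n k : prime (pp n) -> (k <= n)%N ->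
  ('C(n, k)%:R)^-1 \is a pint (pp n).
Proof.
move=> pr kn; apply: pintV; apply: (@coprime_dvdr _ n`!).
  by rewrite -(bin_fact kn) dvdn_mulr.
by apply: coprime_fact => //; lia.
Qed.

(** Reversing the sum turns [2l + 1] into [p - 2 (l + 1)]. *)
Lemma oddharm_harm n : prime (pp n) -> cong (pp n) 1 (oddharm n) (- (harm n / 2)).
Proof.
move=> pr; rewrite /oddharm big_nat_rev /harm mulr_suml -sumrN /=.
apply: cong_sum => k kn.
have kn' : (k.+1%:R <= n%:R :> rat) by rewrite ler_nat.
have k0 := ler0n rat k; rewrite -(natr1 k) in kn'.
rewrite add0n natrB // -(natr1 k).
apply: (@cong_of _ _ _ _ ((2 * (n%:R - (k%:R + 1)) + 1)^-1 / (2 * (k%:R + 1)))) => //.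
  rewrite rpredM //.
    by rewrite natr1 -natrB // pint_inv_odd //; lia.
  by rewrite invfM rpredM ?pint_inv2 ?pint_invS.
by rewrite expr1 pp_natr; field; nonzero.
Qed.

(** * Harmonic sums modulo p *)

Definition harm2 (n : nat) : rat := \sum_(1 <= j < n.+1) 1 / j%:R ^+ 2.
Definition alth (n : nat) : rat := \sum_(1 <= j < n.+1) (-1) ^+ j / j%:R.
Definition alth2 (n : nat) : rat := \sum_(1 <= j < n.+1) (-1) ^+ j / j%:R ^+ 2.
Definition altharm (n : nat) : rat :=
  \sum_(1 <= j < n.+1) (-1) ^+ j * harm j.-1 / j%:R.

Lemma harm1E n : harm n = \sum_(1 <= j < n.+1) 1 / j%:R.
Proof.
rewrite big_add1 /=; apply: eq_bigr => j _; by rewrite natr1 mul1r.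
Qed.

(** The representative in [[1, n]] of half of [(-1)^s s] modulo [p], for [1 <= s <= n]. *)
Definition foldhalf (n s : nat) : nat := if odd s then (pp n - s)./2 else s./2.

Lemma foldhalf_bound n s : (1 <= s < n.+1)%N -> (1 <= foldhalf n s < n.+1)%N.
Proof. by rewrite /foldhalf; case: ifP => h; lia. Qed.

(** An injective map of a finite set into itself is a permutation; values at arguments of different
    parity differ because [s + t < p]. *)
Lemma foldhalf_perm n :
  perm_eq (map (foldhalf n) (index_iota 1 n.+1)) (index_iota 1 n.+1).
Proof.
have sub : {subset map (foldhalf n) (index_iota 1 n.+1) <= index_iota 1 n.+1}.
  move=> x /mapP[s]; rewrite !mem_index_iota => hs ->; exact: foldhalf_bound.
have un : uniq (map (foldhalf n) (index_iota 1 n.+1)).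
  rewrite map_inj_in_uniq ?iota_uniq // => s t.
  rewrite !mem_index_iota /foldhalf; case: ifP => os; case: ifP => ot; lia.
apply: uniq_perm => //; first exact: iota_uniq.
by have [] := uniq_min_size un sub; rewrite ?size_map.
Qed.

Lemma sum_foldhalf n (F : nat -> rat) :
  \sum_(1 <= a < n.+1) F a = \sum_(1 <= s < n.+1) F (foldhalf n s).
Proof. by rewrite -(perm_big _ (foldhalf_perm n)) big_map. Qed.

Lemma pint_inv1 n s : prime (pp n) -> (1 <= s < n.+1)%N ->
  s%:R^-1 \is a pint (pp n).
Proof. by move=> pr hs; rewrite pint_inv //; lia. Qed.

(* Modulo [p], the even residues [2 * a] are the numbers [(-1) ^ s * s]. *)
Lemma foldhalf_inv n s : prime (pp n) -> (1 <= s < n.+1)%N ->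
  cong (pp n) 1 (1 / (foldhalf n s)%:R) (2 * ((-1) ^+ s / s%:R)).
Proof.
move=> pr hs; have s0 : 0 < s%:R :> rat by rewrite ltr0n; lia.
rewrite /foldhalf; case: ifP => os.
  have h : ((pp n - s)./2%:R = ((pp n)%:R - s%:R) / 2 :> rat).
    rewrite -natrB; last by lia.
    have {2}-> : (pp n - s = 2 * (pp n - s)./2)%N by lia.
    by rewrite natrM mulrC mulKf.
  have sp : (s%:R < (pp n)%:R :> rat) by rewrite ltr_nat; lia.
  rewrite h -signr_odd os expr1.
  apply: (@cong_of _ _ _ _ (2 * ((pp n - s)%:R^-1 / s%:R))) => //.
    rewrite rpredM ?rpred_nat //; apply: rpredM; last exact: pint_inv1.
    by rewrite pint_inv //; lia.
  rewrite expr1 natrB; last by lia.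
  move: (pp n)%:R s%:R s0 sp => x y y0 yx.
  by field; nonzero.
have h : (s%:R = s./2%:R *+ 2 :> rat).
  have {1}-> : (s = s./2 * 2)%N by lia.
  by rewrite natrM mulr_natr.
apply: cong_eq; rewrite -signr_odd os expr0 h.
rewrite h in s0; move: (s./2%:R) s0 => x x0.
by field; nonzero.
Qed.

Lemma pint_foldhalf n s : prime (pp n) -> (1 <= s < n.+1)%N ->
  1 / (foldhalf n s)%:R \is a pint (pp n).
Proof.
move=> pr hs; rewrite mul1r pint_inv //.
have := foldhalf_bound _ _ hs; lia.
Qed.

Lemma pint_alt n s : prime (pp n) -> (1 <= s < n.+1)%N ->
  (-1) ^+ s / s%:R \is a pint (pp n).
Proof. by move=> pr hs; rewrite rpredM ?pint_inv1 // rpredX // rpredN1. Qed.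

Lemma harm_alth n : prime (pp n) -> cong (pp n) 1 (harm n) (2 * alth n).
Proof.
move=> pr; rewrite harm1E sum_foldhalf /alth mulr_sumr.
by apply: cong_sum => s hs; exact: foldhalf_inv.
Qed.

(** Reindexing by [foldhalf] squares the signs away and gives [harm2 n = 4 harm2 n] modulo [p];
    since [p > 3], the factor [3] can be divided out. *)
Lemma harm2_cong0 n : prime (pp n) -> (1 < n)%N -> cong (pp n) 1 (harm2 n) 0.
Proof.
move=> pr n1.
have h : cong (pp n) 1 (harm2 n) (4 * harm2 n).
  rewrite {1}/harm2 sum_foldhalf /harm2 mulr_sumr.
  apply: cong_sum => s hs.
  have s0 : 0 < s%:R :> rat by rewrite ltr0n; lia.
  have -> : 4 * (1 / s%:R ^+ 2) = (2 * ((-1) ^+ s / s%:R)) * (2 * ((-1) ^+ s / s%:R)) :> rat.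
    by rewrite mulrACA -[(-1) ^+ s / _ * _]expr2 exprMn sqrr_sign exprVn; field; nonzero.
  have f0 : 0 < (foldhalf n s)%:R :> rat.
    by rewrite ltr0n; have := foldhalf_bound _ _ hs; lia.
  have -> : 1 / (foldhalf n s)%:R ^+ 2 = (1 / (foldhalf n s)%:R) * (1 / (foldhalf n s)%:R) :> rat.
    by field; nonzero.
  apply: congM; [|exact: pint_foldhalf|exact: foldhalf_inv|exact: foldhalf_inv].
  by rewrite rpredM ?rpred_nat ?pint_alt.
have e : harm2 n = 3%:R^-1 * (4 * harm2 n - harm2 n) by field.
rewrite {1}e -[X in cong _ _ _ X](mulr0 3%:R^-1); apply: congMl.
  by rewrite pint_inv //; lia.
by rewrite -[X in cong _ _ _ X](subrr (harm2 n)); apply: congB;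
  [exact: cong_sym | exact: cong_refl].
Qed.

Lemma harm_tail n a : (1 <= a < n.+1)%N ->
  \sum_(1 <= b < n.+1) (n < a + b)%:R / b%:R = harm n - harm (n - a).
Proof.
move=> ha; rewrite !harm1E (@big_cat_nat _ _ _ (n - a).+1) //=; try lia.
rewrite [X in _ = X - _](@big_cat_nat _ _ _ (n - a).+1) //=; try lia.
rewrite big_nat_cond big1 ?add0r; last first.
  move=> b; rewrite andbT => hb; have -> : (n < a + b)%N = false by lia.
  by rewrite mul0r.
rewrite addrC addrK; apply: eq_big_nat => b hb.
by have -> : (n < a + b)%N by lia.
Qed.

(** By induction: for each [a <= n] the inner sum over [a] changes by [- 1 / ((n + 1) (n + 1 - a))].
    These changes total [- harm n / (n + 1)] and leave [1 / (n + 1)^2] of the new last term. *)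
Lemma sum_tail_harm2 n :
  \sum_(1 <= a < n.+1) \sum_(1 <= b < n.+1)
    (n < a + b)%:R * (1 / a%:R) * (1 / b%:R) = harm2 n.
Proof.
transitivity (\sum_(1 <= a < n.+1) (harm n - harm (n - a)) / a%:R).
  apply: eq_big_nat => a ha; rewrite -harm_tail // mulr_suml.
  by apply: eq_bigr => b _; rewrite !mul1r mulrAC.
elim: n => [|n IH]; first by rewrite /harm2 !big_geq.
rewrite big_nat_recr //= /harm2 [RHS]big_nat_recr //= -/(harm2 n) -IH.
have n0 := ler0n rat n.
have -> : \sum_(1 <= a < n.+1) (harm n.+1 - harm (n.+1 - a)) / a%:R
  = \sum_(1 <= a < n.+1) ((harm n - harm (n - a)) / a%:R
     - 1 / (n%:R + 1) * (1 / (n%:R + 1 - a%:R))).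
  apply: eq_big_nat => a /andP[a1 an].
  have [x1 x2] : (1 <= a%:R :> rat) /\ (a%:R <= n%:R :> rat) by rewrite ler1n ler_nat.
  rewrite subSn // !harmS natrB //.
  move: (n%:R) (a%:R) (harm n) (harm (n - a)) n0 x1 x2 => x y u v x0 y1 yx.
  by field; nonzero.
have e : \sum_(1 <= a < n.+1) 1 / (n%:R + 1) * (1 / (n%:R + 1 - a%:R)) = harm n / (n%:R + 1).
  rewrite -mulr_sumr harm1E big_nat_rev /= add1n mulrC mul1r; congr (_ * _).
  apply: eq_big_nat => a ha; congr (1 / _); rewrite natr1 -natrB; last by lia.
  by congr (_%:R); lia.
rewrite sumrB e subnn harm0 harmS -(natr1 n).
by field; nonzero.
Qed.

(** With [x t = (-1)^t / t], the odd-indexed part of [x] is [(x t - 1/t) / 2]. So a new row and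
    column contribute [x n.+1 (alth n - harm n)], whose harmonic part is cancelled by the new term
    of [altharm]. *)
Lemma sum_min_odd n :
  \sum_(1 <= s < n.+1) \sum_(1 <= t < n.+1)
     (odd (minn s t))%:R * ((-1) ^+ s / s%:R) * ((-1) ^+ t / t%:R) + altharm n
  = (alth n ^+ 2 - alth2 n) / 2 :> rat.
Proof.
pose x s : rat := (-1) ^+ s / s%:R.
pose F s t : rat := (odd (minn s t))%:R * x s * x t.
rewrite -[\sum_(1 <= s < n.+1) _]/(\sum_(1 <= s < n.+1) \sum_(1 <= t < n.+1) F s t).
have odd_x t : (0 < t)%N -> (odd t)%:R * x t = (x t - 1 / t%:R) / 2.
  move=> t0; have tp : 0 < t%:R :> rat by rewrite ltr0n.
  rewrite /x -signr_odd; case: (odd t); rewrite /= ?expr1 ?expr0; move: (t%:R) tp => y y0.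
    by field; nonzero.
  by field; nonzero.
elim: n => [|n IH].
  by rewrite /altharm /alth /alth2 !big_geq // expr0n subr0 mul0r addr0.
have e : \sum_(1 <= s < n.+2) \sum_(1 <= t < n.+2) F s t
  = \sum_(1 <= s < n.+1) \sum_(1 <= t < n.+1) F s t
    + 2 * x n.+1 * ((alth n - harm n) / 2) + F n.+1 n.+1.
  rewrite big_nat_recr //= [X in _ + X]big_nat_recr //=.
  have col : \sum_(1 <= s < n.+1) F s n.+1 = x n.+1 * ((alth n - harm n) / 2).
    rewrite /alth harm1E -sumrB mulr_suml mulr_sumr; apply: eq_big_nat => s hs.
    rewrite /F (minn_idPl _); last by lia.
    by rewrite -/(x s) -odd_x; [ring | lia].
  have row : \sum_(1 <= t < n.+1) F n.+1 t = x n.+1 * ((alth n - harm n) / 2).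
    by rewrite -col; apply: eq_bigr => s _; rewrite /F minnC mulrAC.
  under eq_bigr => s _ do rewrite big_nat_recr //=.
  by rewrite big_split /= col row; ring.
have e2 : F n.+1 n.+1 = (x n.+1 ^+ 2 - (-1) ^+ n.+1 / n.+1%:R ^+ 2) / 2.
  have n0 : 0 < n.+1%:R :> rat by rewrite ltr0n.
  rewrite /F minnn odd_x // /x.
  move: ((-1) ^+ n.+1) (n.+1%:R) n0 => u y y0.
  by field; nonzero.
rewrite e e2 /altharm /alth /alth2 !(big_nat_recr n.+1) //=.
rewrite -/(altharm n) -/(alth n) -/(alth2 n) -/(x n.+1).
have -> : altharm n = (alth n ^+ 2 - alth2 n) / 2
  - \sum_(1 <= s < n.+1) \sum_(1 <= t < n.+1) F s t by rewrite -IH [RHS]addrC addKr.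
have -> : (-1) ^+ n.+1 * harm n / n.+1%:R = x n.+1 * harm n by rewrite /x; ring.
set c := _ / n.+1%:R ^+ 2.
by clearbody c x F; clear; field.
Qed.

(** Four times the double sum of [sum_min_odd] is, after reindexing by [foldhalf], the double sum of
    [sum_tail_harm2], hence [harm2 n], which vanishes modulo [p]. *)
Lemma altharm_cong n : prime (pp n) -> (1 < n)%N ->
  cong (pp n) 1 (altharm n) ((alth n ^+ 2 - alth2 n) / 2).
Proof.
move=> pr n1.
set Z := \sum_(1 <= s < n.+1) \sum_(1 <= t < n.+1)
     (odd (minn s t))%:R * ((-1) ^+ s / s%:R) * ((-1) ^+ t / t%:R) : rat.
have e : altharm n = (alth n ^+ 2 - alth2 n) / 2 - Z.
  by have := sum_min_odd n; rewrite -/Z => <-; rewrite [RHS]addrC addKr.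
suff h : cong (pp n) 1 (4 * Z) 0.
  rewrite e -[X in cong _ _ _ X]subr0; apply: congB; first exact: cong_refl.
  have -> : Z = 4%:R^-1 * (4 * Z) by field.
  by rewrite -[X in cong _ _ _ X](mulr0 4%:R^-1); apply: congMl => //; exact: pint_inv4.
apply: cong_trans (harm2_cong0 n pr n1); apply: cong_sym.
rewrite -sum_tail_harm2 sum_foldhalf /Z mulr_sumr.
apply: cong_sum => s hs; rewrite sum_foldhalf mulr_sumr.
apply: cong_sum => t ht.
(* Two even indices give a sum at most [n], two odd ones at least [n + 1]; for mixed parity the sum
   exceeds [n] exactly when the odd index is the smaller one. *)
have -> : (n < foldhalf n s + foldhalf n t)%N = odd (minn s t).
  by rewrite /foldhalf /minn; case: ifP => ?; case: ifP => ?; case: ifP => ?; lia.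
have -> : 4 * ((odd (minn s t))%:R * ((-1) ^+ s / s%:R) * ((-1) ^+ t / t%:R))
  = (odd (minn s t))%:R * (2 * ((-1) ^+ s / s%:R)) * (2 * ((-1) ^+ t / t%:R)) :> rat by ring.
apply: congM; [|exact: pint_foldhalf| |exact: foldhalf_inv].
  apply: rpredM; first exact: rpred_nat.
  by apply: rpredM; [exact: rpred_nat | exact: pint_alt].
by apply: congMl; [exact: rpred_nat | exact: foldhalf_inv].
Qed.

(** * Sums up to n *)

Lemma cong_ecbV n k : prime (pp n) -> (k <= n)%N ->
  cong (pp n) 1 (1 / ecb k) ((-1) ^+ k / 'C(n, k)%:R).
Proof.
move=> pr kn; have e0 := ecb_neq0 k.
have b0 : 'C(n, k)%:R != 0 :> rat by rewrite pnatr_eq0 -lt0n bin_gt0.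
have s1 : (-1) ^+ k * (-1) ^+ k = 1 :> rat by rewrite -expr2 sqrr_sign.
pose w : rat := (ecb k)^-1 * ((-1) ^+ k / 'C(n, k)%:R).
have wp : w \is a pint (pp n).
  by rewrite rpredM ?pint_ecbV // rpredM ?pint_binV // rpredX // rpredN1.
have -> : 1 / ecb k = w * ((-1) ^+ k * 'C(n, k)%:R).
  have -> : w * ((-1) ^+ k * 'C(n, k)%:R)
    = ((-1) ^+ k * (-1) ^+ k) * ((ecb k)^-1 * ('C(n, k)%:R / 'C(n, k)%:R)).
    by rewrite /w; ring.
  by rewrite s1 divff // mulr1.
have -> : (-1) ^+ k / 'C(n, k)%:R = w * ecb k by rewrite /w mulrAC mulVf ?mul1r.
by apply: congMl => //; apply: cong_sym; exact: cong_ecb_alt.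
Qed.

Lemma pint_invecb2 n : prime (pp n) -> invecb2 n \is a pint (pp n).
Proof.
move=> pr; apply: pint_sum => j hj; rewrite mul1r invfM; apply: rpredM.
  by rewrite -exprVn rpredX // pint_invS //; lia.
by apply: pint_ecbV => //; lia.
Qed.

(** Modulo [p], [1 / ecb j] is [(-1)^j / C(n, j)], so [alt_betaf_sum] gives [harm2 n + 2 alth2 n],
    where [harm2 n] vanishes. *)
Lemma invecb2_cong n : prime (pp n) -> (1 < n)%N ->
  cong (pp n) 1 (invecb2 n) (2 * alth2 n).
Proof.
move=> pr n1.
have e : \sum_(1 <= j < n.+1) (1 + 2 * (-1) ^+ j) / j%:R ^+ 2
  = harm2 n + 2 * alth2 n :> rat.
  by rewrite /harm2 /alth2 mulr_sumr -big_split; apply: eq_bigr => j _ /=; ring.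
apply: (@cong_trans _ _ (harm2 n + 2 * alth2 n)); last first.
  rewrite -[X in cong _ _ _ X]add0r; apply: congD; last exact: cong_refl.
  exact: harm2_cong0.
rewrite -e -alt_betaf_sum big_add1 /=; apply: cong_sum => j hj.
have j0 := ler0n rat j.
have b0 : 'C(n, j.+1)%:R != 0 :> rat by rewrite pnatr_eq0 -lt0n bin_gt0; lia.
have e0 := ecb_neq0 j.+1.
have -> : (-1) ^+ j.+1 * betaf n j.+1 / j.+1%:R
  = (j%:R + 1)^-1 ^+ 2 * ((-1) ^+ j.+1 / 'C(n, j.+1)%:R).
  rewrite betafE; last by lia.
  by rewrite -(natr1 j); field; nonzero.
have -> : 1 / ((j%:R + 1) ^+ 2 * ecb j.+1) = (j%:R + 1)^-1 ^+ 2 * (1 / ecb j.+1).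
  by field; nonzero.
apply: congMl; first by rewrite rpredX // pint_invS //; lia.
by apply: cong_ecbV => //; lia.
Qed.

Lemma bt_from1 n f : f 0%N = 0 ->
  bt n f = \sum_(1 <= k < n.+1) (-1) ^+ k * 'C(n, k)%:R * f k.
Proof. by move=> f0; rewrite /bt big_ltn // f0 mulr0 add0r. Qed.

Lemma cong_ecb_bt n f : prime (pp n) -> f 0%N = 0 ->
  (forall k, (1 <= k < n.+1)%N -> f k \is a pint (pp n)) ->
  cong (pp n) 1 (\sum_(1 <= k < n.+1) ecb k * f k) (bt n f).
Proof.
move=> pr f0 fp; rewrite bt_from1 //; apply: cong_sum => k hk.
by apply: congMr; [exact: fp | apply: cong_ecb_alt => //; lia].
Qed.

(** [ecb_odd] governs the first order in [p] of the sum [Q] in [sum_ecb2_cong]; the next two sums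
    make up its second order. *)
Definition ecb_odd (n : nat) : rat :=
  \sum_(1 <= k < n.+1) ecb k * (oddharm k / k%:R).
Definition ecb_odd_k (n : nat) : rat :=
  \sum_(1 <= k < n.+1) ecb k * (oddharm k / k%:R / k%:R).
Definition ecb_odd2 (n : nat) : rat :=
  \sum_(1 <= k < n.+1) ecb k * (oddharm2 k / k%:R).

Lemma pint_oddharm_k n k : prime (pp n) -> (1 <= k < n.+1)%N ->
  oddharm k / k%:R \is a pint (pp n).
Proof. by move=> pr hk; rewrite rpredM ?pint_oddharm ?pint_inv1 //; lia. Qed.

Lemma pint_oddharm2_k n k : prime (pp n) -> (1 <= k < n.+1)%N ->
  oddharm2 k / k%:R \is a pint (pp n).
Proof. by move=> pr hk; rewrite rpredM ?pint_oddharm2 ?pint_inv1 //; lia. Qed.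

Lemma pint_ecb_odd n : prime (pp n) -> ecb_odd n \is a pint (pp n).
Proof.
by move=> pr; apply: pint_sum => k hk; rewrite rpredM ?pint_ecb ?pint_oddharm_k.
Qed.

Lemma pint_ecb_odd_k n : prime (pp n) -> ecb_odd_k n \is a pint (pp n).
Proof.
move=> pr; apply: pint_sum => k hk.
by rewrite rpredM ?pint_ecb // rpredM ?pint_oddharm_k ?pint_inv1.
Qed.

Lemma pint_ecb_odd2 n : prime (pp n) -> ecb_odd2 n \is a pint (pp n).
Proof.
by move=> pr; apply: pint_sum => k hk; rewrite rpredM ?pint_ecb ?pint_oddharm2_k.
Qed.

Lemma ecb_odd_bt n : prime (pp n) ->
  cong (pp n) 1 (ecb_odd n) (- (invecb2 n / 2)).
Proof.
move=> pr; rewrite -bt_oddharm_k; apply: cong_ecb_bt => // [|k hk].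
  by rewrite invr0 mulr0.
exact: pint_oddharm_k.
Qed.

Lemma ecb_odd_cong n : prime (pp n) -> (1 < n)%N ->
  cong (pp n) 1 (ecb_odd n) (- alth2 n).
Proof.
move=> pr n1; apply: (cong_trans _ _ _ _ _ (ecb_odd_bt n pr)).
have -> : alth2 n = 2%:R^-1 * (2 * alth2 n) by field.
rewrite [_ / 2]mulrC; apply: congN; apply: congMl; first exact: pint_inv2.
exact: invecb2_cong.
Qed.

(* The [p^3]-coefficients of the two sides of the congruence between
   [sum ecb k ^ 2] and [csum] differ by this quantity. *)
Lemma ecb_odd_relation n : prime (pp n) ->
  cong (pp n) 1 (oddharm n * ecb_odd n + ecb_odd_k n / 2 - ecb_odd2 n) 0.
Proof.
move=> pr.
have h1 := ecb_odd_bt n pr.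
have h2 : cong (pp n) 1 (ecb_odd_k n) (bt n (fun k => oddharm k / k%:R / k%:R)).
  apply: cong_ecb_bt => // [|k hk]; first by rewrite invr0 mulr0.
  by rewrite rpredM ?pint_oddharm_k ?pint_inv1.
have h3 : cong (pp n) 1 (ecb_odd2 n) (bt n (fun k => oddharm2 k / k%:R)).
  apply: cong_ecb_bt => // [|k hk]; first by rewrite invr0 mulr0.
  exact: pint_oddharm2_k.
rewrite bt_oddharm_k2 in h2; rewrite bt_oddharm2_k in h3.
set Sh := \sum_(0 <= j < n) harm j / ((j%:R + 1) ^+ 2 * ecb j.+1) in h3.
have e : \sum_(0 <= j < n) (harm n - harm j) / ((j%:R + 1) ^+ 2 * ecb j.+1)
  = harm n * invecb2 n - Sh.
  rewrite /Sh /invecb2 mulr_sumr -sumrB; apply: eq_bigr => j _; ring.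
rewrite e in h2.
have h : cong (pp n) 1 (oddharm n * ecb_odd n + ecb_odd_k n / 2 - ecb_odd2 n)
  (oddharm n * - (invecb2 n / 2) + (- (harm n * invecb2 n - Sh) / 2) / 2 - Sh / 4).
  apply: congB => //; apply: congD.
    by apply: congMl => //; exact: pint_oddharm.
  by apply: congMr => //; exact: pint_inv2.
apply: (cong_trans _ _ _ _ _ h).
have -> : oddharm n * - (invecb2 n / 2) + (- (harm n * invecb2 n - Sh) / 2) / 2 - Sh / 4
  = (invecb2 n / 2) * (- (harm n / 2) - oddharm n) by field.
rewrite -[X in cong _ _ _ X](mulr0 (invecb2 n / 2)); apply: congMl.
  by rewrite rpredM ?pint_invecb2 ?pint_inv2.
rewrite -[X in cong _ _ _ X](subrr (oddharm n)); apply: congB; last exact: cong_refl.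
by apply: cong_sym; exact: oddharm_harm.
Qed.

(** In the difference of the two binomial expansions the terms in [1] and [p^2] cancel, so the
    linear term is already correct modulo [p^3]. *)
Lemma csum_cong n : prime (pp n) ->
  cong (pp n) 3 (3 / 2 * csum n) (2 * (pp n)%:R * ecb_odd n).
Proof.
move=> pr.
have e : 3 / 2 * csum n
  = \sum_(1 <= k < n.+1) ('C(n + k, k)%:R - (-1) ^+ k * 'C(n, k)%:R) / k%:R.
  have h1 := csum_diag n; have h2 := bt_inv n.
  rewrite bt_from1 in h2; last by rewrite invr0 mulr0.
  have -> : 3 / 2 * csum n = (3 / 2 * csum n - harm n) - (- harm n) by ring.
  rewrite -h1 -h2 -sumrB; apply: eq_bigr => k _; ring.
rewrite e /ecb_odd mulr_sumr; apply: cong_sum => k hk.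
have kn : (k <= n)%N by lia.
have [r rp ->] := bin_add_expand n k pr kn.
have [s sp ->] := bin_alt_expand n k pr kn.
apply: (@cong_of _ _ _ _ (ecb k * (r + s) / k%:R)) => //.
  by rewrite rpredM ?pint_inv1 // rpredM ?pint_ecb ?rpredD.
ring.
Qed.

Lemma sign_ecb n : prime (pp n) ->
  cong (pp n) 2 ((-1) ^+ n * ecb n) (1 + (pp n)%:R * oddharm n).
Proof.
move=> pr; have [r rp] := bin_alt_expand n n pr (leqnn n).
rewrite binn mulr1; set P := (pp n)%:R => e.
have Pp : P \is a pint (pp n) by exact: rpred_nat.
set X := (-1) ^+ n * ecb n; set O := oddharm n.
pose s := oddharm2 n - P * r.
have Op : O \is a pint (pp n) by exact: pint_oddharm.
have sp : s \is a pint (pp n) by rewrite rpredB ?pint_oddharm2 ?rpredM.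
have Xp : X \is a pint (pp n) by rewrite rpredM ?pint_ecb // rpredX // rpredN1.
have h : X * (1 - P * O + P ^+ 2 * s) = 1.
  transitivity ((-1) ^+ n * (ecb n * (1 - P * oddharm n + P ^+ 2 * oddharm2 n - P ^+ 3 * r))).
    by rewrite /X /s /O; ring.
  by rewrite -e -expr2 sqrr_sign.
(* By [h], [X - (1 + P O)] is [X (1 - (1 + P O) (1 - P O + P^2 s))]; the witness is this divided by
   [P^2]. *)
apply: (@cong_of _ _ _ _ (X * (O ^+ 2 - s * (1 + P * O)))) => //.
  by rewrite rpredM // rpredB ?rpredX // rpredM // rpredD ?rpred1 // rpredM.
have h' : 1 + P * O = (1 + P * O) * (X * (1 - P * O + P ^+ 2 * s)) by rewrite h mulr1.
by rewrite [Y in _ = Y + _]h'; ring.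
Qed.

(** This is [bt_odd_inv] read backwards, as [2 (n - k) + 1 = p - 2k]. It has the shape of
    [sum_ecb2], so the two can be subtracted term by term. *)
Lemma sign_ecb_sum n :
  (-1) ^+ n = (pp n)%:R * ecb n
    * \sum_(0 <= k < n.+1) (-1) ^+ k * 'C(n, k)%:R / ((pp n)%:R - 2 * k%:R).
Proof.
have := bt_odd_inv n; rewrite /bt big_nat_rev /= => h.
have e : \sum_(0 <= k < n.+1) (-1) ^+ k * 'C(n, k)%:R / ((pp n)%:R - 2 * k%:R)
  = (-1) ^+ n * (1 / ((2 * n%:R + 1) * ecb n)).
  rewrite -h mulr_sumr; apply: eq_big_nat => k hk.
  have kn : (k <= n)%N by lia.
  rewrite add0n subSS bin_sub // natrB // pp_natr.
  have -> : (-1) ^+ n = (-1) ^+ (n - k) * (-1) ^+ k :> rat by rewrite -exprD subnK.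
  have -> : 2 * (n%:R - k%:R) + 1 = 2 * n%:R + 1 - 2 * k%:R :> rat by ring.
  set d := (_ - _ : rat).
  have -> : (-1) ^+ (n - k) * (-1) ^+ k * ((-1) ^+ (n - k) * 'C(n, k)%:R * (1 / d))
    = ((-1) ^+ (n - k)) ^+ 2 * ((-1) ^+ k * 'C(n, k)%:R / d) :> rat by ring.
  by rewrite sqrr_sign mul1r.
rewrite e pp_natr; have n0 := ler0n rat n; have e0 := ecb_neq0 n.
by field; nonzero.
Qed.

Lemma sum_ecb2_cong n : prime (pp n) ->
  cong (pp n) 4 ((-1) ^+ n * \sum_(0 <= k < n.+1) ecb k ^+ 2)
    (1 - (pp n)%:R ^+ 2 * (ecb_odd n / 2)).
Proof.
move=> pr; set S2 := \sum_(0 <= k < n.+1) ecb k ^+ 2.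
set P : rat := (pp n)%:R.
have Pp : P \is a pint (pp n) by exact: rpred_nat.
pose Q := \sum_(1 <= k < n.+1) (ecb k - (-1) ^+ k * 'C(n, k)%:R) / (P - 2 * k%:R).
have eS : S2 = (-1) ^+ n + P * ecb n * Q.
  rewrite /S2 sum_ecb2 -pp_natr -/P (sign_ecb_sum n) -/P -mulrDr; congr (_ * _).
  (* The two terms at [k = 0], the only ones with denominator [P], agree and drop out of [Q]. *)
  rewrite big_ltn // [X in _ = X + _]big_ltn // expr0 bin0 ecb0 mul1r -addrA; congr (_ + _).
  rewrite /Q -big_split; apply: eq_bigr => k _ /=; ring.
have hQ : cong (pp n) 3 Q
    (- (P * ecb_odd n + P ^+ 2 * (ecb_odd_k n / 2 - ecb_odd2 n)) / 2).
  have -> : - (P * ecb_odd n + P ^+ 2 * (ecb_odd_k n / 2 - ecb_odd2 n)) / 2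
    = \sum_(1 <= k < n.+1) - (ecb k * (P * oddharm k
        + P ^+ 2 * (oddharm k / (2 * k%:R) - oddharm2 k)) / (2 * k%:R)).
    rewrite /ecb_odd /ecb_odd_k /ecb_odd2 mulr_suml -sumrB !mulr_sumr -big_split /=.
    rewrite -sumrN mulr_suml; apply: eq_big_nat => k hk.
    have k0 : 0 < k%:R :> rat by rewrite ltr0n; lia.
    by move: (k%:R) k0 => x x0; field; nonzero.
  apply: cong_sum => k hk; have kn : (k <= n)%N by lia.
  have [r rp ->] := bin_alt_expand n k pr kn.
  have k0 : 0 < k%:R :> rat by rewrite ltr0n; lia.
  have kP : 2 * k%:R < P by rewrite -natrM ltr_nat; lia.
  have wp : (P - 2 * k%:R)^-1 \is a pint (pp n).
    by rewrite -natrM -natrB ?pint_inv //; lia.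
  have vp : (k%:R^-1 / 2) \is a pint (pp n) by apply: rpredM; [exact: pint_inv1 | exact: pint_inv2].
  have Op : oddharm k \is a pint (pp n) by exact: pint_oddharm.
  have ep : oddharm2 k \is a pint (pp n) by exact: pint_oddharm2.
  set w := (P - 2 * k%:R)^-1 in wp *; set v := (k%:R^-1 / 2) in vp.
  (* The remainder comes from the exact expansion [w = - v - P v^2 + P^2 v^2 w]. *)
  apply: (@cong_of _ _ _ _ (ecb k * (r * w + oddharm2 k * v ^+ 2
      + oddharm k * v ^+ 2 * w - P * oddharm2 k * v ^+ 2 * w))) => //.
    by have := pint_ecb n k pr => ?; pint_split.
  rewrite -/P /w /v.
  move: (P) (k%:R) (ecb k) (oddharm k) (oddharm2 k) k0 kP => x y z t u y0 yx.
  by field; nonzero.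
have hX := sign_ecb n pr; rewrite -/P in hX.
set X := (-1) ^+ n * ecb n in hX.
set O := oddharm n in hX.
have [c cp eQ] := congE _ _ _ _ (ltn0Sn _) hQ.
have [d dp eX] := congE _ _ _ _ (ltn0Sn _) hX.
have [g gp eR] := congE _ _ _ _ (ltn0Sn _) (ecb_odd_relation n pr).
have Op : O \is a pint (pp n) by exact: pint_oddharm.
have Xp : X \is a pint (pp n) by rewrite rpredM ?pint_ecb // rpredX // rpredN1.
have e : (-1) ^+ n * S2 = 1 + P * X * Q.
  rewrite eS mulrDr -expr2 sqrr_sign /X; congr (_ + _); ring.
have h2 := pint_inv2 n pr.
have o1 := pint_ecb_odd n pr; have o2 := pint_ecb_odd_k n pr; have o3 := pint_ecb_odd2 n pr.
set a := ecb_odd n in eQ eR o1 *.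
pose b := ecb_odd_k n / 2 - ecb_odd2 n.
have bp : b \is a pint (pp n) by rewrite rpredB // rpredM.
(* The coefficient of [P^3] in [P X Q] is [- (O a + b) / 2], and [ecb_odd_relation] makes it a
   multiple of [P]. *)
have eR' : O * a = P * g - b.
  have -> : P * g = 0 + P ^+ 1 * g by rewrite add0r expr1.
  by rewrite -eR /b /O; ring.
apply: (@cong_of _ _ _ _ (X * c - 2%:R^-1 * (d * a + g + O * b + P * d * b))) => //.
  by pint_split.
rewrite e eQ -/b eX.
have -> : P ^+ 4 * ((1 + P * O + P ^+ 2 * d) * c - 2^-1 * (d * a + g + O * b + P * d * b))
  = P ^+ 4 * ((1 + P * O + P ^+ 2 * d) * c - 2^-1 * (d * a + O * b + P * d * b))
    - P ^+ 3 / 2 * (P * g) by ring.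
have -> : P * g = O * a + b by rewrite eR' subrK.
by field.
Qed.

(** * Sums weighted by powers of 1/2 *)

Definition ecb_half_odd (n : nat) : rat :=
  \sum_(0 <= k < n.+1) ecb k * (oddharm k / 2%:R ^+ k).
Definition ecb_half_odd2 (n : nat) : rat :=
  \sum_(0 <= k < n.+1) ecb k * (oddharm2 k / 2%:R ^+ k).

Lemma bin_ecbV_cong n j : prime (pp n) -> (j <= n)%N ->
  cong (pp n) 1 ('C(n, j)%:R / ecb j) ((-1) ^+ j).
Proof.
move=> pr jn; have e0 := ecb_neq0 j.
have -> : 'C(n, j)%:R / ecb j = ((-1) ^+ j / ecb j) * ((-1) ^+ j * 'C(n, j)%:R).
  transitivity (((-1) ^+ j) ^+ 2 * ('C(n, j)%:R / ecb j)); last by ring.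
  by rewrite sqrr_sign mul1r.
rewrite -[X in cong _ _ _ X](divfK e0).
apply: congMl; last by apply: cong_sym; exact: cong_ecb_alt.
by rewrite rpredM ?pint_ecbV // rpredX // rpredN1.
Qed.

(** [bt_half] reduces this to the transforms of [oddharm], whose factor [1 / ecb j] meets [C(n, j)]
    and leaves a sign modulo [p]. *)
Lemma ecb_half_odd_cong n : prime (pp n) ->
  cong (pp n) 1 (ecb_half_odd n) (- (alth n / 2) / 2%:R ^+ n).
Proof.
move=> pr.
apply: (@cong_trans _ _ (bt n (fun k => oddharm k / 2%:R ^+ k))).
  apply: cong_sum => k hk; apply: congMr; last by apply: cong_ecb_alt => //; lia.
  by rewrite rpredM ?pint_inv_exp2 // pint_oddharm //; lia.
rewrite bt_half; apply: congMr; first exact: pint_inv_exp2.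
rewrite big_nat_recl // bt0 oddharm0 mulr0 add0r.
rewrite /alth mulr_suml -sumrN big_add1 /=; apply: cong_sum => j hj.
have j0 := ler0n rat j; have e0 := ecb_neq0 j.+1.
have -> : 'C(n, j.+1)%:R * bt j.+1 oddharm
  = (- (j%:R + 1)^-1 / 2) * ('C(n, j.+1)%:R / ecb j.+1).
  by rewrite bt_oddharm; field; nonzero.
have -> : - ((-1) ^+ j.+1 / j.+1%:R / 2) = (- (j%:R + 1)^-1 / 2) * (-1) ^+ j.+1 :> rat.
  by rewrite -(natr1 j); ring.
apply: congMl; last by apply: bin_ecbV_cong => //; lia.
by rewrite rpredM ?pint_inv2 // rpredN pint_invS //; lia.
Qed.

Lemma ecb_half_odd2_cong n : prime (pp n) ->
  cong (pp n) 1 (ecb_half_odd2 n) (altharm n / 4 / 2%:R ^+ n).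
Proof.
move=> pr.
apply: (@cong_trans _ _ (bt n (fun k => oddharm2 k / 2%:R ^+ k))).
  apply: cong_sum => k hk; apply: congMr; last by apply: cong_ecb_alt => //; lia.
  by rewrite rpredM ?pint_inv_exp2 // pint_oddharm2 //; lia.
rewrite bt_half; apply: congMr; first exact: pint_inv_exp2.
rewrite big_nat_recl // bt0 oddharm20 mulr0 add0r.
rewrite /altharm mulr_suml big_add1 /=; apply: cong_sum => j hj.
have j0 := ler0n rat j; have e0 := ecb_neq0 j.+1.
have -> : 'C(n, j.+1)%:R * bt j.+1 oddharm2
  = (harm j / 4 * (j%:R + 1)^-1) * ('C(n, j.+1)%:R / ecb j.+1).
  by rewrite bt_oddharm2; field; nonzero.
have -> : (-1) ^+ j.+1 * harm j / j.+1%:R / 4 = (harm j / 4 * (j%:R + 1)^-1) * (-1) ^+ j.+1 :> rat.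
  by rewrite -(natr1 j); ring.
apply: congMl; last by apply: bin_ecbV_cong => //; lia.
apply: rpredM; last by apply: pint_invS => //; lia.
by rewrite rpredM ?pint_inv4 // pint_harm //; lia.
Qed.

Lemma bt_exp2V n : bt n (fun k => 1 / 2%:R ^+ k) = (2%:R ^+ n)^-1.
Proof.
rewrite bt_half big_nat_recl // bt0 bin0 mulr1 big1 ?addr0 ?mul1r // => j _.
by rewrite bt_const mulr0.
Qed.

(** Subtracting [bt_exp2V] from [bin_half_sum] cancels the even orders below [p^3]; adding them, as
    in [exp2_sum_cong], cancels the linear one. *)
Lemma exp2_diff_cong n : prime (pp n) ->
  cong (pp n) 3 (2%:R ^+ n - (2%:R ^+ n)^-1) (2 * (pp n)%:R * ecb_half_odd n).
Proof.
move=> pr; rewrite -bt_exp2V -{1}bin_half_sum /bt -sumrB /ecb_half_odd mulr_sumr.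
apply: cong_sum => k hk; have kn : (k <= n)%N by lia.
have [r rp ->] := bin_add_expand n k pr kn.
have [s sp ->] := bin_alt_expand n k pr kn.
have ep := pint_ecb n k pr; have tp := pint_inv_exp2 n k pr.
apply: (@cong_of _ _ _ _ (ecb k * (r + s) * (2%:R ^+ k)^-1)) => //; first by pint_split.
ring.
Qed.

Lemma exp2_sum_cong n : prime (pp n) ->
  cong (pp n) 3 (2%:R ^+ n + (2%:R ^+ n)^-1)
    (2 * (\sum_(0 <= k < n.+1) ecb k / 2%:R ^+ k)
     + 2 * (pp n)%:R ^+ 2 * ecb_half_odd2 n).
Proof.
move=> pr; rewrite -bt_exp2V -{1}bin_half_sum /bt -big_split /=.
rewrite /ecb_half_odd2 !mulr_sumr -big_split /=.
apply: cong_sum => k hk; have kn : (k <= n)%N by lia.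
have [r rp ->] := bin_add_expand n k pr kn.
have [s sp ->] := bin_alt_expand n k pr kn.
have ep := pint_ecb n k pr; have tp := pint_inv_exp2 n k pr.
apply: (@cong_of _ _ _ _ (ecb k * (r - s) * (2%:R ^+ k)^-1)) => //; first by pint_split.
ring.
Qed.

Lemma pint_alth n : prime (pp n) -> alth n \is a pint (pp n).
Proof. by move=> pr; apply: pint_sum => k hk; exact: pint_alt. Qed.

Lemma pint_alth2 n : prime (pp n) -> alth2 n \is a pint (pp n).
Proof.
move=> pr; apply: pint_sum => k hk; rewrite -exprVn rpredM ?rpredX ?rpredN1 //.
exact: pint_inv1.
Qed.

(* [2 * eta] is the Fermat quotient of 2 modulo [p]. *)
Lemma exp2_eta n d eta : prime (pp n) -> d ^+ 2 = 1 -> d \is a pint (pp n) ->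
  eta \is a pint (pp n) -> 2%:R ^+ n = d * (1 + (pp n)%:R * eta) ->
  cong (pp n) 1 (2 * eta) (- alth n).
Proof.
move=> pr d2 dp ep e; set P : rat := (pp n)%:R in e.
set x : rat := 2%:R ^+ n in e; set y := x^-1.
have x0 : x != 0 by rewrite expf_neq0.
have yp : y \is a pint (pp n) by exact: pint_inv_exp2.
have ey : y = d - P * eta * y.
  have h : d * (1 + P * eta) * y = 1 by rewrite -e mulfV.
  have -> : d - P * eta * y = d * (d * (1 + P * eta) * y) - P * eta * y by rewrite h mulr1.
  have -> : d * (d * (1 + P * eta) * y) = d ^+ 2 * ((1 + P * eta) * y) by ring.
  by rewrite d2; ring.
have [c cp ec] := congE _ _ _ _ (ltn0Sn _) (exp2_diff_cong n pr).
have [g gp eg] := congE _ _ _ _ (ltn0Sn _) (ecb_half_odd_cong n pr).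
rewrite -/P -/x -/y in ec eg.
have P0 : P != 0 by rewrite pnatr_eq0.
have ap := pint_alth n pr.
have h : d * (2 * eta) = - alth n * y + 2 * P * g + P ^+ 2 * c + P * eta ^+ 2 * y.
  apply: (mulfI P0).
  have -> : P * (d * (2 * eta)) = (x - y) + P ^+ 2 * eta ^+ 2 * y.
    rewrite e; have -> : d * (1 + P * eta) - y = d * (1 + P * eta) - (d - P * eta * y) by rewrite -ey.
    have -> : d * (1 + P * eta) - (d - P * eta * y) = P * eta * (d + y) by ring.
    have -> : P * eta * (d + y) = P * eta * (d + (d - P * eta * y)) by rewrite -ey.
    ring.
  by rewrite ec eg; field.
have Pp : P \is a pint (pp n) by exact: rpred_nat.
apply: (@cong_of _ _ _ _ (d * (2 * g + P * c + eta ^+ 2 * y) + d * alth n * eta * y)) => //.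
  by pint_split.
have -> : 2 * eta = d * (d * (2 * eta)) by rewrite mulrA -expr2 d2 mul1r.
rewrite h expr1 -/P.
have -> : d * (- alth n * y + 2 * P * g + P ^+ 2 * c + P * eta ^+ 2 * y)
  = - alth n * (d * y) + P * d * (2 * g + P * c + eta ^+ 2 * y) by ring.
have -> : d * y = 1 - P * d * eta * y.
  have -> : d * y = d * (d - P * eta * y) by rewrite -ey.
  by rewrite mulrBr -expr2 d2; ring.
ring.
Qed.

(** The squares of [alth n] cancel: [2^n + 2^(-n)] contributes one through [eta^2], with
    [eta = - alth n / 2] modulo [p], and [altharm_cong] contributes the other. *)
Lemma sum_ecb_half_cong n d eta : prime (pp n) -> (1 < n)%N -> d ^+ 2 = 1 ->
  d \is a pint (pp n) -> eta \is a pint (pp n) ->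
  2%:R ^+ n = d * (1 + (pp n)%:R * eta) ->
  cong (pp n) 3 (\sum_(0 <= k < n.+1) ecb k / 2%:R ^+ k)
    (d + d * (pp n)%:R ^+ 2 * alth2 n / 8).
Proof.
move=> pr n1 d2 dp ep e.
have [f fp ef] := congE _ _ _ _ (ltn0Sn _) (exp2_eta n d eta pr d2 dp ep e).
set P : rat := (pp n)%:R in e ef *.
set x : rat := 2%:R ^+ n in e; set y := x^-1.
have x0 : x != 0 by rewrite expf_neq0.
have yp : y \is a pint (pp n) by exact: pint_inv_exp2.
(* As [d^2 = 1], the inverse [y] of [2^n] satisfies [y (1 + P eta) = d]. *)
have ey : y = d - P * eta * y.
  have h : d * (1 + P * eta) * y = 1 by rewrite -e mulfV.
  have -> : d - P * eta * y = d * (d * (1 + P * eta) * y) - P * eta * y by rewrite h mulr1.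
  have -> : d * (d * (1 + P * eta) * y) = d ^+ 2 * ((1 + P * eta) * y) by ring.
  by rewrite d2; ring.
have [c cp ec] := congE _ _ _ _ (ltn0Sn _) (exp2_sum_cong n pr).
have [g gp eg] := congE _ _ _ _ (ltn0Sn _) (ecb_half_odd2_cong n pr).
have [k kp ek] := congE _ _ _ _ (ltn0Sn _) (altharm_cong n pr n1).
rewrite -/P -/x -/y in ec eg ek.
set S := \sum_(0 <= k < n.+1) _ in ec *.
have ap := pint_alth n pr; have bp := pint_alth2 n pr.
set A := alth n in ek ef ap; set B := alth2 n in ek bp *.
have exy : x + y = 2 * d + P ^+ 2 * eta ^+ 2 * y.
  rewrite e; have -> : d * (1 + P * eta) + y = d * (1 + P * eta) + (d - P * eta * y) by rewrite -ey.
  have -> : d * (1 + P * eta) + (d - P * eta * y) = 2 * d + P * eta * (d - y) by ring.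
  have -> : d - y = P * eta * y by rewrite {1}ey; ring.
  by ring.
have eS : S = d + P ^+ 2 / 2 * eta ^+ 2 * y - P ^+ 2 * (altharm n / 4 * y + P * g) - P ^+ 3 / 2 * c.
  have -> : S = (x + y - 2 * P ^+ 2 * ecb_half_odd2 n - P ^+ 3 * c) / 2 by rewrite ec; field.
  by rewrite exy eg; field.
have eh : eta = (- A + P * f) / 2 by rewrite -[P]expr1 -ef; field.
have Pp : P \is a pint (pp n) by exact: rpred_nat.
have h2 := pint_inv2 n pr; have h4 := pint_inv4 n pr.
apply: (@cong_of _ _ _ _ (2%:R^-1 * (4%:R^-1 * (- 2 * A * f + P * f ^+ 2)) * y
   - 4%:R^-1 * k * y - g - 2%:R^-1 * c - 2%:R^-1 * 4%:R^-1 * B * eta * y)) => //.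
  by pint_split.
have ed : d = y + P * eta * y by rewrite {1}ey subrK.
rewrite eS ek [in X in X = _]eh -/P.
have -> : d + d * P ^+ 2 * B / 8 = d + (y + P * eta * y) * P ^+ 2 * B / 8 by rewrite -ed.
by field.
Qed.

(** * Sums between n and p *)

Lemma ecb_sqr_cong n : prime (pp n) -> cong (pp n) 1 (ecb n ^+ 2) 1.
Proof.
move=> pr; rewrite -(sqrr_sign rat n) !expr2.
have h := cong_ecb_alt n n pr (leqnn n); rewrite binn mulr1 in h.
apply: congM => //; first by rewrite rpredX // rpredN1.
exact: pint_ecb.
Qed.

(** The square of [1 + p oddharm n], where [oddharm n = - harm n / 2 = - alth n] modulo [p]. *)
Lemma ecb_sqr_cong2 n : prime (pp n) ->
  cong (pp n) 2 (ecb n ^+ 2) (1 - 2 * (pp n)%:R * alth n).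
Proof.
move=> pr.
have [c cp ec] := congE _ _ _ _ (ltn0Sn _) (sign_ecb n pr).
have [d dp ed] := congE _ _ _ _ (ltn0Sn _) (oddharm_harm n pr).
have [g gp eg] := congE _ _ _ _ (ltn0Sn _) (harm_alth n pr).
set P : rat := (pp n)%:R in ec ed eg *.
have Pp : P \is a pint (pp n) by exact: rpred_nat.
have ap : alth n \is a pint (pp n) by apply: pint_sum => k hk; exact: pint_alt.
have Op : oddharm n \is a pint (pp n) by exact: pint_oddharm.
have h2 := pint_inv2 n pr.
have -> : ecb n ^+ 2 = (1 + P * oddharm n + P ^+ 2 * c) ^+ 2.
  by rewrite -ec [RHS]exprMn sqrr_sign mul1r.
apply: (@cong_of _ _ _ _ (2 * (d - 2%:R^-1 * g) + 2 * c * (1 + P * oddharm n)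
   + oddharm n ^+ 2 + P ^+ 2 * c ^+ 2)) => //.
  by pint_split.
have eO : oddharm n = - alth n + P * (d - 2^-1 * g) by rewrite ed eg expr1; field.
have -> : (1 + P * oddharm n + P ^+ 2 * c) ^+ 2
  = 1 + 2 * P * oddharm n + P ^+ 2 * (2 * c * (1 + P * oddharm n)
   + oddharm n ^+ 2 + P ^+ 2 * c ^+ 2) by ring.
rewrite [X in 1 + 2 * P * X]eO -/P; ring.
Qed.

Lemma pint_ppS n : prime (pp n) -> ((pp n)%:R + 1)^-1 \is a pint (pp n).
Proof.
move=> pr; have -> : (pp n)%:R + 1 = 2 * n.+1%:R :> rat by rewrite natr1 -natrM; congr (_%:R); lia.
rewrite invfM rpredM ?pint_inv2 // pint_inv //.
by case: n pr => // n _; lia.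
Qed.

(** With [k = n + 1 + j] one has [n - j = p - k]. The factor [2n + 1 = p] enters the numerator of
    [ecb] at [k = n + 1], and [c] is what remains after removing it. *)
Lemma ecb_tail n j : prime (pp n) -> (j < n)%N ->
  exists c, [/\ c \is a pint (pp n), ecb (n.+1 + j) = (pp n)%:R * c
    & cong (pp n) 1 (2 * (n%:R - j%:R) * ecb (n - j) * c) (-1)].
Proof.
move=> pr; set P : rat := (pp n)%:R.
have Pp : P \is a pint (pp n) by exact: rpred_nat.
elim: j => [|j IH] jn.
  have Vp := pint_ppS n pr; have ep := pint_ecb n n pr.
  have n0 := ler0n rat n.
  exists (ecb n / (P + 1)); split.
  - by rewrite rpredM.
  - by rewrite addn0 ecbS /P pp_natr; field; nonzero.
  - rewrite subn0 subr0.
    have -> : 2 * n%:R * ecb n * (ecb n / (P + 1)) = ((P - 1) / (P + 1)) * ecb n ^+ 2.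
      by rewrite /P pp_natr; field; nonzero.
    apply: (@cong_trans _ _ ((P - 1) / (P + 1) * 1)).
      apply: congMl; last exact: ecb_sqr_cong.
      by rewrite rpredM // rpredB // rpred1.
    apply: (@cong_of _ _ _ _ (2 / (P + 1))) => //; first by rewrite rpredM ?rpred_nat.
    by rewrite expr1 -/P /P pp_natr; field; nonzero.
have [c [cp ec hc]] := IH (ltnW jn).
have j0 := ler0n rat j.
have jn' : j%:R + 1 + 1 <= n%:R :> rat by rewrite !natr1 ler_nat.
have Vp : (P + 2 * j%:R + 3)^-1 \is a pint (pp n).
  have -> : P + 2 * j%:R + 3 = 2 * (n + j).+2%:R.
    by rewrite /P pp_natr -[(n + j).+2%:R]natr1 -[(n + j).+1%:R]natr1 natrD; ring.
  rewrite invfM; apply: rpredM; first exact: pint_inv2.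
  by rewrite pint_inv //; lia.
have Wp : (P - 2 * j%:R - 2)^-1 \is a pint (pp n).
  have -> : P - 2 * j%:R - 2 = 2 * (n - j.+1)%:R + 1.
    by rewrite natrB 1?ltnW // -(natr1 j) /P pp_natr; ring.
  by apply: pint_inv_odd => //; lia.
have jp : j%:R \is a pint (pp n) by exact: rpred_nat.
(* The ratio of consecutive values of [ecb] at [k = n + 1 + j] is [(2k + 1) / (2k + 2)], with
   [2k + 1 = P + 2j + 2]. *)
exists (c * ((P + 2 * j%:R + 2) * (P + 2 * j%:R + 3)^-1)); split.
- by pint_split.
- rewrite addnS ecbS ec natrD -(natr1 n) /P pp_natr.
  have n0 := ler0n rat n.
  by move: (n%:R) (j%:R) n0 j0 => x y x0 y0; field; nonzero.
have e1 : ecb (n - j) = ecb (n - j.+1) * (2 * (n%:R - j%:R - 1) + 1) / (2 * (n%:R - j%:R)).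
  have -> : (n - j = (n - j.+1).+1)%N by lia.
  rewrite ecbS natrB 1?ltnW // -(natr1 j).
  move: (n%:R) (j%:R) (ecb _) j0 jn' => x y z y0 yx.
  by field; nonzero.
set V := 2 * (n%:R - j%:R) * ecb (n - j) * c in hc.
(* Moving to [j + 1] multiplies the product [V] by a factor that is [1] modulo [P]. *)
have -> : 2 * (n%:R - j.+1%:R) * ecb (n - j.+1) * (c * ((P + 2 * j%:R + 2) * (P + 2 * j%:R + 3)^-1))
  = (1 - 2 * P * ((P - 2 * j%:R - 2)^-1 * (P + 2 * j%:R + 3)^-1)) * V.
  rewrite /V e1 -(natr1 j) /P pp_natr.
  move: (n%:R) (j%:R) (ecb _) j0 jn' => x y z y0 yx.
  by field; nonzero.
apply: (@cong_trans _ _ ((1 - 2 * P * ((P - 2 * j%:R - 2)^-1 * (P + 2 * j%:R + 3)^-1)) * -1)).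
  by apply: congMl => //; pint_split.
apply: (@cong_of _ _ _ _ (2 * ((P - 2 * j%:R - 2)^-1 * (P + 2 * j%:R + 3)^-1))) => //.
  by pint_split.
rewrite expr1 -/P; ring.
Qed.

(** Modulo [p] the summand is [betaf n i ^+ 2]. Staver's identity carries a factor [p] on the left,
    and [csum_cong] supplies a matching one on the right, so [p] can be cancelled. *)
Lemma invecb4_cong n : prime (pp n) -> (1 < n)%N ->
  cong (pp n) 1 (\sum_(1 <= i < n.+1) (1 / i%:R) ^+ 2 * (1 / ecb i) ^+ 2)
    (- 4 * (-1) ^+ n * alth2 n).
Proof.
move=> pr n1; set P : rat := (pp n)%:R.
have Pp : P \is a pint (pp n) by exact: rpred_nat.
pose R := \sum_(1 <= k < n.+1) betaf n k ^+ 2.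
have Rp : R \is a pint (pp n).
  apply: pint_sum => k hk; rewrite betafE //.
  rewrite mul1r invfM; apply: rpredX; apply: rpredM; first exact: pint_inv1.
  by apply: pint_binV => //; lia.
apply: (@cong_trans _ _ R).
  apply: cong_sum => k hk.
  have k0 : k%:R != 0 :> rat by rewrite pnatr_eq0; lia.
  have b0 : 'C(n, k)%:R != 0 :> rat by rewrite pnatr_eq0 -lt0n bin_gt0; lia.
  have -> : betaf n k ^+ 2 = (1 / k%:R) ^+ 2 * (((-1) ^+ k / 'C(n, k)%:R) ^+ 2).
    rewrite betafE // [X in _ = _ * X]exprMn sqrr_sign mul1r.
    by field; rewrite b0 k0.
  apply: congMl; first by rewrite mul1r rpredX ?pint_inv1.
  have h : cong (pp n) 1 (1 / ecb k) ((-1) ^+ k / 'C(n, k)%:R).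
    by apply: cong_ecbV => //; lia.
  rewrite !expr2; apply: congM => //.
    by rewrite rpredM ?rpredX ?rpredN1 // pint_binV //; lia.
  by rewrite mul1r pint_ecbV //; lia.
have [c cp ec] := congE _ _ _ _ (ltn0Sn _) (csum_cong n pr).
have hs := staver n; rewrite -/R -pp_natr -/P in hs.
rewrite -/P in ec.
have P0 : P != 0 by rewrite pnatr_eq0.
have hb : 'C(2 * n, n)%:R * R = 4 * ecb_odd n + P ^+ 2 * 2 * c.
  apply: (mulfI P0); rewrite mulrA hs.
  have -> : 3 * csum n = 2 * (3 / 2 * csum n) by field.
  rewrite ec; ring.
have hc : cong (pp n) 1 'C(2 * n, n)%:R ((-1) ^+ n).
  apply: (@cong_trans _ _ (ecb n)).
    have -> : 'C(2 * n, n) = 'C(n + n, n) by rewrite mul2n -addnn.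
    have [r rp ->] := bin_add_expand n n pr (leqnn n).
    have Op : oddharm n \is a pint (pp n) by exact: pint_oddharm.
    have ep : oddharm2 n \is a pint (pp n) by exact: pint_oddharm2.
    have bp := pint_ecb n n pr.
    apply: (@cong_of _ _ _ _ (ecb n * (oddharm n + P * oddharm2 n + P ^+ 2 * r))) => //.
      by pint_split.
    rewrite expr1 -/P; ring.
  by have := cong_ecb_alt n n pr (leqnn n); rewrite binn mulr1.
have sp : (-1) ^+ n \is a pint (pp n) by rewrite rpredX // rpredN1.
apply: (@cong_trans _ _ ((-1) ^+ n * ('C(2 * n, n)%:R * R))).
  have e : R = (-1) ^+ n * ((-1) ^+ n * R) by rewrite mulrA -expr2 sqrr_sign mul1r.
  rewrite {1}e; apply: congMl => //; apply: congMr => //; exact: cong_sym.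
have -> : - 4 * (-1) ^+ n * alth2 n = (-1) ^+ n * (4 * - alth2 n) by ring.
apply: congMl => //; rewrite hb.
apply: (@cong_trans _ _ (4 * ecb_odd n)).
  apply: (@cong_of _ _ _ _ (P * 2 * c)) => //; first by pint_split.
  rewrite expr1 -/P; ring.
by apply: congMl; [exact: rpred_nat | exact: ecb_odd_cong].
Qed.

Lemma sum_ecb2_tail n : prime (pp n) -> (1 < n)%N ->
  cong (pp n) 3 (\sum_(n.+1 <= k < pp n) ecb k ^+ 2)
    (- (pp n)%:R ^+ 2 * ((-1) ^+ n * alth2 n)).
Proof.
move=> pr n1; set P : rat := (pp n)%:R.
have Pp : P \is a pint (pp n) by exact: rpred_nat.
have -> : - P ^+ 2 * ((-1) ^+ n * alth2 n)
  = P ^+ 2 * (4%:R^-1 * (- 4 * (-1) ^+ n * alth2 n)) by field.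
apply: (@cong_trans _ _ (P ^+ 2 * (4%:R^-1 * \sum_(1 <= i < n.+1) (1 / i%:R) ^+ 2 * (1 / ecb i) ^+ 2))).
  rewrite mulr_sumr mulr_sumr.
  (* The sum over [i] is reversed so that [k = n + 1 + j] faces [i = n - j = p - k]. *)
  rewrite [X in cong _ _ _ X]big_nat_rev /= [X in cong _ _ _ X]big_add1 /=.
  rewrite -{1}(add0n n.+1) big_addn.
  have -> : (pp n - n.+1 = n)%N by lia.
  apply: cong_sum => j hj.
  have jn : (j < n)%N by lia.
  have [c [cp ec hc]] := ecb_tail n j pr jn.
  rewrite addnC ec exprMn -[3%N]/(2 + 1)%N; apply: cong_scale => //.
  have -> : (1 + n.+1 - j.+2 = n - j)%N by lia.
  have [g gp eg] := congE _ _ _ _ (ltn0Sn _) hc.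
  have x0 : (n - j)%:R != 0 :> rat by rewrite pnatr_eq0; lia.
  have e0 := ecb_neq0 (n - j).
  have xp : ((n - j)%:R)^-1 \is a pint (pp n) by rewrite pint_inv //; lia.
  have ep : (ecb (n - j))^-1 \is a pint (pp n) by apply: pint_ecbV => //; lia.
  have h2 := pint_inv2 n pr.
  rewrite -natrB in eg; last by lia.
  have -> : c = (-1 + P ^+ 1 * g) * (2%:R^-1 * (n - j)%:R^-1 * (ecb (n - j))^-1).
    by rewrite -eg; field; rewrite x0 e0.
  apply: (@cong_of _ _ _ _ ((- 2 * g + P * g ^+ 2) * (2%:R^-1 * (n - j)%:R^-1 * (ecb (n - j))^-1) ^+ 2)) => //.
    by pint_split.
  rewrite expr1 -/P.
  move: ((n - j)%:R) (ecb (n - j)) x0 e0 => x y x0 y0.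
  by field; rewrite x0 y0.
rewrite -[3%N]/(2 + 1)%N; apply: cong_scale => //; apply: congMl; first exact: pint_inv4.
exact: invecb4_cong.
Qed.

(** The sum telescopes; both boundary terms are [p^2] times a square congruent to [1]. *)
Lemma sum_lin_ecb2_tail n : prime (pp n) -> (1 < n)%N ->
  cong (pp n) 3 (\sum_(n.+1 <= k < pp n) (4 * k%:R + 1) * ecb k ^+ 2) 0.
Proof.
move=> pr n1; set P : rat := (pp n)%:R.
have Pp : P \is a pint (pp n) by exact: rpred_nat.
have n0 := ler0n rat n.
rewrite sum_lin_ecb2; last by lia.
have -> : 4 * n.+1%:R ^+ 2 * ecb n.+1 ^+ 2 = P ^+ 2 * ecb n ^+ 2.
  by rewrite ecbS /P pp_natr -(natr1 n); field; nonzero.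
(* The index [j = n - 1] reaches [k = p - 1], next to [ecb p]; there [n - j = 1] and [2 ecb 1 = 1],
   so [c] itself is [- 1] modulo [P]. *)
have jn : (n.-1 < n)%N by lia.
have [c [cp ec hc]] := ecb_tail n n.-1 pr jn.
have e1 : (n.+1 + n.-1 = 2 * n)%N by lia.
have e2 : (n - n.-1 = 1)%N by lia.
rewrite e1 in ec; rewrite -natrB ?e2 in hc; last by lia.
have -> : ecb (pp n) = c * (2 * P - 1) / 2.
  by rewrite ecbS ec natrM /P pp_natr; field; nonzero.
have hc' : cong (pp n) 1 c (-1).
  have e : 2 * 1%:R * ecb 1 * c = c by rewrite ecbS ecb0; field.
  by rewrite e in hc.
have -> : 4 * P ^+ 2 * (c * (2 * P - 1) / 2) ^+ 2 - P ^+ 2 * ecb n ^+ 2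
  = P ^+ 2 * ((c * (2 * P - 1)) ^+ 2 - ecb n ^+ 2) by field.
rewrite -[X in cong _ _ _ X](mulr0 (P ^+ 2)) -[3%N]/(2 + 1)%N; apply: cong_scale => //.
rewrite -[X in cong _ _ _ X](subrr 1); apply: congB; last exact: ecb_sqr_cong.
have [g gp ->] := congE _ _ _ _ (ltn0Sn _) hc'.
apply: (@cong_of _ _ _ _ ((- 2 * g + P * g ^+ 2) * (2 * P - 1) ^+ 2 + (4 * P - 4))) => //.
  by pint_split.
rewrite !expr1 -/P; ring.
Qed.

(** * Euler numbers modulo p *)

Lemma sum_nat_shift (R : nmodType) a b (F : nat -> R) :
  \sum_(a <= i < a + b) F i = \sum_(0 <= i < b) F (i + a)%N.
Proof. by rewrite -{1}[a]add0n big_addn addKn. Qed.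

(* The umbral polynomial [(E + y) ^ N]. *)
Definition euler_poly (N : nat) (y : int) : int :=
  \sum_(0 <= k < N.+1) 'C(N, k)%:R * euler (N - k) * y ^+ k.

Lemma euler_sum0_even m : (0 < m)%N ->
  \sum_(0 <= j < m.+1) (1 + (-1) ^+ j) * ('C(m, j)%:R * euler (m - j)) = 0.
Proof.
move=> m0.
transitivity (2 * \sum_(0 <= k < m.+1 | (2 %| k)%N) 'C(m, k)%:R * euler (m - k)); last first.
  by rewrite euler_sum0 // mulr0.
rewrite [in RHS]big_mkcond mulr_sumr; apply: eq_bigr => j _; rewrite dvdn2 -signr_odd.
by case: (odd j); rewrite /= ?expr1 ?expr0 ?subrr ?mul0r ?mulr0.
Qed.

(** The coefficient of [y^i] is [C(N, i)] times the umbral [(E + 1)^(N - i) + (E - 1)^(N - i)],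
    which vanishes unless [i = N]. *)
Lemma euler_poly_shift N y :
  euler_poly N (y + 1) + euler_poly N (y - 1) = 2 * y ^+ N.
Proof.
have expand z : euler_poly N (y + z) = \sum_(0 <= i < N.+1) \sum_(0 <= k < N.+1)
    ('C(N, k) * 'C(k, i))%:R * euler (N - k) * z ^+ (k - i) * y ^+ i.
  rewrite exchange_big_nat /=; apply: eq_big_nat => k hk.
  rewrite addrC exprDn mulr_sumr -(big_mkord xpredT (fun i => 'C(N, k)%:R * euler (N - k) * (z ^+ (k - i) * y ^+ i *+ 'C(k, i)))).
  rewrite [RHS](@big_cat_nat _ _ _ k.+1) //=.
  rewrite [X in _ = _ + X]big_nat_cond [X in _ = _ + X]big1 ?addr0; last first.
    move=> i; rewrite andbT => hi; rewrite [X in (_ * X)%:R]bin_small; last by lia.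
    by rewrite muln0 !mul0r.
  by apply: eq_bigr => i _; rewrite natrM -mulr_natr; ring.
rewrite !expand -big_split /=.
have term i : (i < N.+1)%N ->
  \sum_(0 <= k < N.+1) ('C(N, k) * 'C(k, i))%:R * euler (N - k) * 1 ^+ (k - i) * y ^+ i
  + \sum_(0 <= k < N.+1) ('C(N, k) * 'C(k, i))%:R * euler (N - k) * (-1) ^+ (k - i) * y ^+ i
  = if i == N then 2 * y ^+ N else 0.
  move=> iN; rewrite -big_split /= (@big_cat_nat _ _ _ i) //=; last by lia.
  rewrite big_nat_cond big1 ?add0r; last first.
    move=> k; rewrite andbT => hk; rewrite [X in (_ * X)%:R]bin_small; last by lia.
    by rewrite muln0 !mul0r addr0.
  rewrite -{1}(add0n i) big_addn subSn; last by lia.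
  transitivity ('C(N, i)%:R * y ^+ i * \sum_(0 <= j < (N - i).+1)
    (1 + (-1) ^+ j) * ('C(N - i, j)%:R * euler (N - i - j))).
    rewrite mulr_sumr; apply: eq_big_nat => j hj.
    have -> : ('C(N, j + i) * 'C(j + i, i) = 'C(N, i) * 'C(N - i, j))%N.
      have h1 : ('C(N, j + i) * 'C(j + i, i) * (i`! * j`! * (N - i - j)`!) = N`!)%N.
        have a1 : (j + i <= N)%N by lia.
        have a2 : (i <= j + i)%N by lia.
        rewrite -(bin_fact a1) -(bin_fact a2).
        have -> : (j + i - i = j)%N by lia.
        have -> : (N - (j + i) = N - i - j)%N by lia.
        by ring.
      have h2 : ('C(N, i) * 'C(N - i, j) * (i`! * j`! * (N - i - j)`!) = N`!)%N.
        have a1 : (i <= N)%N by lia.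
        have a2 : (j <= N - i)%N by lia.
        rewrite -(bin_fact a1) -(bin_fact a2).
        by ring.
      apply/eqP; rewrite -(eqn_pmul2r (m := i`! * j`! * (N - i - j)`!)) ?muln_gt0 ?fact_gt0 //.
      by rewrite h1 h2.
    rewrite addnK expr1n natrM.
    have -> : (N - (j + i) = N - i - j)%N by lia.
    by ring.
  case: eqP => [-> | /eqP ne].
    by rewrite subnn big_nat1 binn bin0 expr0 euler0 !mul1r mulr1 mulrC.
  by rewrite euler_sum0_even ?mulr0 //; lia.
rewrite (eq_big_nat _ _ (F2 := fun i => if i == N then 2 * y ^+ N else 0)) //.
rewrite big_nat_recr //= eqxx big_nat_cond big1 ?add0r // => i.
by rewrite andbT => hi; rewrite ltn_eqF //; lia.
Qed.

Lemma euler_poly_mod N y : exists z, euler_poly N y = euler N + y * z.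
Proof.
rewrite /euler_poly big_nat_recl // bin0 subn0 expr0 mul1r mulr1.
exists (\sum_(0 <= k < N) 'C(N, k.+1)%:R * euler (N - k.+1) * y ^+ k).
by rewrite mulr_sumr; congr (_ + _); apply: eq_bigr => k _; rewrite exprS mulrCA.
Qed.

Lemma euler_alt_sum N n :
  \sum_(0 <= i < (2 * n).+1) (-1) ^+ i * (2 * (2 * i%:R - 2 * n%:R) ^+ N)
  = euler_poly N (- (pp n)%:R) + euler_poly N (pp n)%:R :> int.
Proof.
pose t i : int := - ((-1) ^+ i * euler_poly N (2 * i%:R - 2 * n%:R - 1)).
transitivity (t (2 * n).+1 - t 0%N); last first.
  rewrite /t expr0 mul1r opprK addrC -signr_odd; congr (euler_poly N _ + _).
    by rewrite -(natr1 (2 * n)) natrM; ring.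
  have -> : odd (2 * n).+1 = true by lia.
  rewrite expr1 mulN1r opprK; congr (euler_poly N _).
  by rewrite -(natr1 (2 * n)) natrM; ring.
rewrite -telescope_sumr //; apply: eq_bigr => i _.
rewrite -euler_poly_shift /t exprS -(natr1 i).
have -> : 2 * (i%:R + 1) - 2 * n%:R - 1 = 2 * i%:R - 2 * n%:R + 1 :> int by ring.
by ring.
Qed.

(** For even [N] the summand is symmetric about [i = n], where it vanishes. *)
Lemma alt_even_fold (n N : nat) : ~~ odd N -> (0 < N)%N ->
  \sum_(0 <= i < (2 * n).+1) (-1) ^+ i * (2 * (2 * i%:R - 2 * n%:R) ^+ N)
  = (-1) ^+ n * \sum_(1 <= m < n.+1) (-1) ^+ m * (4 * (2 * m%:R) ^+ N) :> int.
Proof.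
move=> eN N0.
have -> : ((2 * n).+1 = n.+1 + n)%N by lia.
rewrite (@big_cat_nat _ _ _ n) //=; last by lia.
rewrite [X in _ + X]big_ltn; last by lia.
rewrite subrr expr0n (gtn_eqF N0) /= !mulr0 add0r (sum_nat_shift _ n.+1 n).
rewrite big_nat_rev [in RHS]big_add1 /= -big_split mulr_sumr.
apply: eq_big_nat => m hm /=.
have -> : (0 + n - m.+1 = n - m.+1)%N by lia.
rewrite natrB; last by lia.
rewrite natrD.
have -> : 2 * (n%:R - m.+1%:R) - 2 * n%:R = - (2 * m.+1%:R) :> int by ring.
have -> : 2 * (m%:R + n.+1%:R) - 2 * n%:R = 2 * m.+1%:R :> int by ring.
rewrite [(- (2 * _)) ^+ N]exprNn -[(-1) ^+ N]signr_odd (negbTE eN) expr0 mul1r.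
have -> : (-1) ^+ (n - m.+1) = (-1) ^+ n * (-1) ^+ m.+1 :> int.
  by rewrite -exprD -signr_odd -[RHS]signr_odd; congr ((-1) ^+ nat_of_bool _); lia.
have -> : (m + n.+1 = n + m.+1)%N by lia.
by rewrite exprD; ring.
Qed.

Lemma pint_fermat n m : prime (pp n) -> (1 <= m < n.+1)%N -> (1 < n)%N ->
  cong (pp n) 1 ((2 * m%:R) ^+ (pp n - 3)) (1 / (2 * m%:R) ^+ 2).
Proof.
move=> pr hm n1.
have x0 : (2 * m)%:R != 0 :> rat by rewrite pnatr_eq0; lia.
have := fermat_little (2 * m) pr; move/eqP.
rewrite eqn_mod_dvd; last by rewrite -{1}(expn1 (2 * m)) leq_pexp2l //; lia.
case/dvdnP=> z /(congr1 (fun u => u%:R : rat)).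
rewrite natrB; last by rewrite -{1}(expn1 (2 * m)) leq_pexp2l //; lia.
rewrite natrX [(z * _)%:R]natrM => hz.
have xp : (2 * m)%:R^-1 \is a pint (pp n) by rewrite pint_inv //; lia.
rewrite -natrM; apply: (@cong_of _ _ _ _ (z%:R * (2 * m)%:R^-1 ^+ 3)) => //.
  by pint_split.
have e : (2 * m)%:R ^+ (pp n) = (2 * m)%:R ^+ (pp n - 3) * (2 * m)%:R ^+ 3 :> rat.
  by rewrite -exprD subnK //; lia.
apply: (mulIf (expf_neq0 3 x0)); rewrite -e.
have -> : (2 * m)%:R ^+ (pp n) = z%:R * (pp n)%:R + (2 * m)%:R :> rat by rewrite -hz subrK.
by move: (2 * m)%:R x0 => y y0; field.
Qed.

Lemma intr_cong p m (a b z : int) : (0 < p)%N -> a = b + p%:Z ^+ m * z ->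
  cong p m a%:~R b%:~R.
Proof.
move=> p0 ->; apply: (@cong_of _ _ _ _ z%:~R) => //; first exact: pint_int.
by rewrite rmorphD rmorphM rmorphXn.
Qed.

(** Modulo [p] both end values in [euler_alt_sum] are [euler N], while Fermat's little theorem turns
    the powers [(2m)^(p - 3)] into [1 / (2m)^2]. *)
Lemma euler_cong n : prime (pp n) -> (1 < n)%N ->
  cong (pp n) 1 (euler (pp n - 3))%:~R ((-1) ^+ n * alth2 n / 2).
Proof.
move=> pr n1; set N := (pp n - 3)%N.
have eN : ~~ odd N by rewrite /N; lia.
have N0 : (0 < N)%N by rewrite /N; lia.
have h := euler_alt_sum N n; rewrite alt_even_fold // in h.
have [z1 e1] := euler_poly_mod N (- (pp n)%:R).
have [z2 e2] := euler_poly_mod N (pp n)%:R.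
have h1 : cong (pp n) 1 ((-1) ^+ n * \sum_(1 <= m < n.+1) (-1) ^+ m * (4 * (2 * m%:R) ^+ N))
    (2 * (euler N)%:~R).
  have -> : 2 * (euler N)%:~R = (2 * euler N)%:~R :> rat by rewrite rmorphM.
  have -> : (-1) ^+ n * \sum_(1 <= m < n.+1) (-1) ^+ m * (4 * (2 * m%:R) ^+ N)
    = ((-1) ^+ n * \sum_(1 <= m < n.+1) (-1) ^+ m * (4 * (2 * m%:R) ^+ N) : int)%:~R :> rat.
    rewrite rmorphM rmorphXn rmorphN1 rmorph_sum; congr (_ * _); apply: eq_bigr => i _.
    by rewrite rmorphM rmorphXn rmorphN1 rmorphM rmorphXn rmorphM /= !rmorph_nat.
  apply: (@intr_cong _ _ _ _ (z2 - z1)) => //.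
  by rewrite h e1 e2 expr1; ring.
have h2 : cong (pp n) 1 ((-1) ^+ n * \sum_(1 <= m < n.+1) (-1) ^+ m * (4 * (2 * m%:R) ^+ N))
    ((-1) ^+ n * alth2 n).
  apply: congMl; first by rewrite rpredX // rpredN1.
  apply: cong_sum => m hm.
  have m0 : m%:R != 0 :> rat by rewrite pnatr_eq0; lia.
  have -> : (-1) ^+ m / m%:R ^+ 2 = (-1) ^+ m * (4 * (1 / (2 * m%:R) ^+ 2)) :> rat by field.
  apply: congMl; first by rewrite rpredX // rpredN1.
  by apply: congMl; [exact: rpred_nat | exact: pint_fermat].
have -> : (euler N)%:~R = 2%:R^-1 * (2 * (euler N)%:~R) :> rat by field.
rewrite [_ / 2]mulrC; apply: congMl; first exact: pint_inv2.
exact: cong_trans (cong_sym _ _ _ _ h1) h2.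
Qed.

(** * The Legendre symbol *)

Lemma Fp_natr_eq p (a b : nat) : prime p ->
  (a%:R == b%:R :> 'F_p) = (a == b %[mod p])%N.
Proof.
move=> pr; rewrite -val_eqE /= !val_Fp_nat //.
Qed.

Lemma Fp_intr_eq0 p (z : int) : prime p -> (z%:~R == 0 :> 'F_p) = (p %| z)%Z.
Proof.
move=> pr; have base (k : nat) : (k%:R == 0 :> 'F_p) = (p %| k)%N.
  by rewrite -[0]/(0%:R) Fp_natr_eq // mod0n.
case: z => k; first by rewrite base.
by rewrite NegzE rmorphN oppr_eq0 base dvdzE abszN.
Qed.

Lemma euler_criterion (n : nat) (a : int) : prime (pp n) -> ~~ (pp n %| a)%Z ->
  (a%:~R ^+ n = (legendre a (pp n))%:~R :> 'F_(pp n)).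
Proof.
move=> pr na; rewrite /legendre (negbTE na).
have a0 : a%:~R != 0 :> 'F_(pp n) by rewrite Fp_intr_eq0.
have fermat (x : 'F_(pp n)) : x != 0 -> x ^+ (2 * n) = 1.
  move=> x0; apply: (mulfI x0); rewrite -exprS mulr1.
  rewrite -[x in LHS]natr_Zp -[x in RHS]natr_Zp -natrX; apply/eqP.
  by rewrite Fp_natr_eq // fermat_little.
have eqmod (x : nat) : (x%:Z ^+ 2 == a %[mod pp n])%Z = (x%:R ^+ 2 == a%:~R :> 'F_(pp n)).
  by rewrite eqz_mod_dvd -Fp_intr_eq0 // rmorphB rmorphXn subr_eq0.
case: existsP => [[x] | nx].
  rewrite eqmod => /eqP xa; rewrite -xa -exprM fermat //.
  by apply: contraNneq a0 => x0; rewrite -xa x0 expr0n.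
have : (a%:~R ^+ n) ^+ 2 = 1 :> 'F_(pp n) by rewrite -exprM [(n * 2)%N]mulnC fermat.
move/eqP; rewrite sqrf_eq1 => /orP[/eqP an | /eqP ->]; last first.
  by rewrite rmorphN1.
(* If [a^n = 1] for a nonresidue [a], then [a] and the [n] distinct squares would be [n + 1] roots
   of [X^n - 1]. *)
pose rs : seq 'F_(pp n) := a%:~R :: [seq i%:R ^+ 2 | i <- iota 1 n].
have n0 : (0 < n)%N by case: (n) pr.
have ninj i j : (0 < i <= n)%N -> (0 < j <= n)%N ->
    i%:R ^+ 2 = j%:R ^+ 2 :> 'F_(pp n) -> i = j.
  move=> hi hj /eqP; rewrite eqf_sqr -addr_eq0 -natrD -[X in _ || (_ == X)]/(0%:R).
  have ip : (i < pp n)%N by lia.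
  have jp : (j < pp n)%N by lia.
  have ijp : (i + j < pp n)%N by lia.
  rewrite !Fp_natr_eq // mod0n !modn_small //.
  by clear -hi hj; case/orP=> /eqP; lia.
have := @max_poly_roots _ ('X^n - 1) rs.
have sz : size ('X^n - 1 : {poly 'F_(pp n)}) = n.+1 by rewrite size_XnsubC.
rewrite sz -size_poly_eq0 sz => /(_ isT).
have -> : all (root ('X^n - 1)) rs.
  rewrite /= rootE !hornerE an subrr eqxx /=.
  apply/allP => _ /mapP[i hi ->]; rewrite rootE !hornerE -exprM fermat ?subrr //.
  rewrite -[0]/(0%:R) Fp_natr_eq // mod0n; move: hi; rewrite mem_iota => hi.
  by clear -hi; rewrite modn_small; lia.
have -> : uniq rs.
  rewrite /= map_inj_in_uniq ?iota_uniq ?andbT; last first.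
    by move=> i j; rewrite !mem_iota => hi hj; apply: ninj; lia.
  apply/mapP=> -[i hi ai]; apply: nx; move: hi; rewrite mem_iota => hi.
  have ip : (i < pp n)%N by lia.
  by exists (Ordinal ip); rewrite eqmod /= ai.
by move=> /(_ isT isT); rewrite /= size_map size_iota ltnn.
Qed.

Lemma legendre_sqr (a : int) (p : nat) : ~~ (p %| a)%Z -> legendre a p ^+ 2 = 1.
Proof. by move=> na; rewrite /legendre (negbTE na); case: ifP. Qed.

Lemma legendre_dvd (n : nat) (a : int) : prime (pp n) -> ~~ (pp n %| a)%Z ->
  (pp n %| a ^+ n - legendre a (pp n))%Z.
Proof.
move=> pr na; rewrite -Fp_intr_eq0 // rmorphB rmorphXn subr_eq0.
by rewrite euler_criterion.
Qed.

(** Euler's criterion gives the equality modulo [p]; both sides are [1] or [- 1], and [p > 2]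
    separates these. *)
Lemma legendre_neg2 n : prime (pp n) -> (1 < n)%N ->
  legendre (-2) (pp n) = (-1) ^+ n * legendre 2 (pp n).
Proof.
move=> pr n1.
have n2 : ~~ (pp n %| 2)%Z by apply/negP => /(dvdn_leq (ltn0Sn 1)); lia.
have n2' : ~~ (pp n %| -2)%Z by apply/negP => /(dvdn_leq (ltn0Sn 1)); lia.
have gt2 : (pp n <= 2)%N = false by clear -n1; lia.
have h1 := legendre_dvd n _ pr n2; have h2 := legendre_dvd n _ pr n2'.
have : (pp n %| (-1) ^+ n * legendre 2 (pp n) - legendre (-2) (pp n))%Z.
  have -> : (-1) ^+ n * legendre 2 (pp n) - legendre (-2) (pp n)
    = ((-2) ^+ n - legendre (-2) (pp n)) - (-1) ^+ n * (2 ^+ n - legendre 2 (pp n)) :> int.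
    by rewrite -[(-2) ^+ n]/((- (2 : int)) ^+ n) [(- 2) ^+ n]exprNn; ring.
  by rewrite rpredB // dvdz_mull.
have : legendre 2 (pp n) ^+ 2 = 1 by exact: legendre_sqr.
have : legendre (-2) (pp n) ^+ 2 = 1 by exact: legendre_sqr.
move/eqP; rewrite sqrf_eq1 => /orP[] /eqP ->;
move/eqP; rewrite sqrf_eq1 => /orP[] /eqP ->;
rewrite -signr_odd; case: (odd n); rewrite /= ?expr0 ?expr1 //;
by move=> /(dvdn_leq (ltn0Sn 1)) le2; have : (pp n <= 2)%N := le2; rewrite gt2.
Qed.

(** * Rewriting the sums of the statement and assembling the congruences *)

Lemma ecb_sqrE k : 'C(2 * k, k)%:R ^+ 2 / 16%:R ^+ k = ecb k ^+ 2.
Proof.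
have -> : 16%:R = 4%:R ^+ 2 :> rat by ring.
by rewrite /ecb expr_div_n -!exprM [(k * 2)%N]mulnC.
Qed.

Lemma ecb_halfE k : 'C(2 * k, k)%:R / 8%:R ^+ k = ecb k / 2%:R ^+ k.
Proof.
rewrite /ecb -mulrA -invfM -exprMn; congr (_ / _ ^+ _); ring.
Qed.

Lemma exp2_legendre n : prime (pp n) -> (1 < n)%N ->
  exists2 eta, eta \is a pint (pp n) &
    2%:R ^+ n = (legendre 2 (pp n))%:~R * (1 + (pp n)%:R * eta) :> rat.
Proof.
move=> pr n1.
have n2 : ~~ (pp n %| 2)%Z by apply/negP => /(dvdn_leq (ltn0Sn 1)); lia.
have /dvdzP[z hz] := legendre_dvd n _ pr n2.
have d2 := legendre_sqr 2 (pp n) n2.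
set d := legendre 2 (pp n) in hz d2 *.
exists (d%:~R * z%:~R); first by rewrite rpredM // pint_int.
have -> : 2%:R ^+ n = (d + z * (pp n)%:Z)%:~R :> rat.
  by rewrite -hz addrC subrK rmorphXn.
rewrite mulrDr mulr1 rmorphD rmorphM /=; congr (_ + _).
have : (d%:~R ^+ 2 = 1 :> rat) by rewrite -rmorphXn d2.
move: (d%:~R : rat) (z%:~R : rat) => x y x2.
transitivity (x ^+ 2 * (y * (pp n)%:R)); last by ring.
by rewrite x2 mul1r.
Qed.

Lemma sum_gt_half n (F : nat -> rat) :
  \sum_(0 <= k < pp n | (pp n < 2 * k)%N) F k = \sum_(n.+1 <= k < pp n) F k.
Proof.
rewrite big_mkcond (@big_cat_nat _ _ _ n.+1) //=; last by lia.
rewrite big_nat_cond big1 ?add0r; last first.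
  by move=> k; rewrite andbT => hk; case: ifP => //; lia.
by apply: eq_big_nat => k hk; have -> : (pp n < 2 * k)%N by lia.
Qed.

Lemma sum_k_ecb2 m n : \sum_(m <= k < n) k%:R * ecb k ^+ 2
  = (\sum_(m <= k < n) (4 * k%:R + 1) * ecb k ^+ 2 - \sum_(m <= k < n) ecb k ^+ 2) / 4.
Proof.
rewrite -sumrB mulr_suml; apply: eq_bigr => k _; by field.
Qed.

(** The telescoped sum ends in [4 (n + 1)^2 ecb n.+1 ^+ 2], which equals [p^2 ecb n ^+ 2]. *)
Lemma sum_k_ecb2_half n : \sum_(0 <= k < n.+1) k%:R * ecb k ^+ 2
  = ((pp n)%:R ^+ 2 * ecb n ^+ 2 - \sum_(0 <= k < n.+1) ecb k ^+ 2) / 4.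
Proof.
rewrite sum_k_ecb2 sum_lin_ecb2 // ecbS pp_natr -(natr1 n); congr ((_ - _) / _).
have n0 := ler0n rat n; rewrite mulr0n expr0n /= mulr0 mul0r subr0.
by field; nonzero.
Qed.


Lemma cong_ratcong p m a b : cong p m a b -> ratcong p m a b.
Proof. by rewrite /cong pintE. Qed.



Theorem theorem1p2 (p : nat) (p_prime : prime p) (p_gt3 : (3 < p)%N) :
  (ratcong p 3
     (\sum_(0 <= k < ((p - 1) %/ 2).+1) 'C(2 * k, k)%:R / 8%:R ^+ k)
     ((legendre 2 p)%:~R
      + (legendre (-2) p)%:~R * (p%:R ^+ 2 / 4%:R) * (euler (p - 3))%:~R))
  /\ (ratcong p 3
     (\sum_(0 <= k < ((p - 1) %/ 2).+1) 'C(2 * k, k)%:R ^+ 2 / 16%:R ^+ k)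
     ((-1) ^+ ((p - 1) %/ 2) + p%:R ^+ 2 * (euler (p - 3))%:~R))
  /\ (ratcong p 3
     (\sum_(0 <= k < ((p - 1) %/ 2).+1)
        k%:R * 'C(2 * k, k)%:R ^+ 2 / 16%:R ^+ k)
     ((-1) ^+ ((p + 1) %/ 2) / 4%:R
      + p%:R ^+ 2 / 4%:R * (1 - (euler (p - 3))%:~R)))
  /\ (ratcong p 3
     (\sum_(0 <= k < p | (p < 2 * k)%N) 'C(2 * k, k)%:R ^+ 2 / 16%:R ^+ k)
     (- 2%:R * p%:R ^+ 2 * (euler (p - 3))%:~R))
  /\ (ratcong p 3
     (\sum_(0 <= k < p | (p < 2 * k)%N)
        k%:R * 'C(2 * k, k)%:R ^+ 2 / 16%:R ^+ k)
     (p%:R ^+ 2 / 2%:R * (euler (p - 3))%:~R))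
  /\ (ratcong p 4
     ((-1) ^+ ((p - 1) %/ 2) *
      \sum_(0 <= k < ((p - 1) %/ 2).+1) 'C(2 * k, k)%:R ^+ 2 / 16%:R ^+ k)
     (1 - 3%:R / 8%:R * p%:R *
          \sum_(1 <= k < ((p - 1) %/ 2).+1) 'C(2 * k, k)%:R / k%:R))
  /\ (ratcong p 4
     (\sum_(0 <= k < ((p - 1) %/ 2).+1)
        k%:R * 'C(2 * k, k)%:R ^+ 2 / 16%:R ^+ k)
     ((-1) ^+ ((p + 1) %/ 2) / 4%:R
      + p%:R ^+ 2 / 4%:R * (2%:R ^+ p - 1)
      + (-1) ^+ ((p - 1) %/ 2) * (3%:R / 32%:R) * p%:R *
          \sum_(1 <= k < ((p - 1) %/ 2).+1) 'C(2 * k, k)%:R / k%:R)).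
Proof.
have [n pE] : exists n, p = pp n.
  by exists p./2; have := even_prime p_prime; case: (boolP (odd p)) => op; lia.
subst p; rename p_prime into pr.
have n1 : (1 < n)%N by lia.
have -> : ((pp n - 1) %/ 2 = n)%N by lia.
have -> : ((pp n + 1) %/ 2 = n.+1)%N by lia.
have [e ep he] := congE _ _ _ _ (ltn0Sn _) (euler_cong n pr n1).
set E : rat := (euler (pp n - 3))%:~R in he *.
have [eta etap heta] := exp2_legendre n pr n1.
have n2 : ~~ (pp n %| 2)%Z by apply/negP => /(dvdn_leq (ltn0Sn 1)); clear -n1; lia.
have d2 : (legendre 2 (pp n))%:~R ^+ 2 = 1 :> rat.
  by rewrite -rmorphXn legendre_sqr.
rewrite legendre_neg2 // rmorphM rmorphXn rmorphN1.
have dp := pint_int (pp n) (legendre 2 (pp n)).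
set d : rat := (legendre 2 (pp n))%:~R in heta d2 dp *.
(* Every congruence needed becomes an equation with a named integral remainder; each claim below is
   then a field identity whose witness collects these remainders. *)
have [c1 c1p h1] := congE _ _ _ _ (ltn0Sn _) (sum_ecb_half_cong n d eta pr n1 d2 dp etap heta).
have [c2 c2p h2] := congE _ _ _ _ (ltn0Sn _) (sum_ecb2_cong n pr).
have [c3 c3p h3] := congE _ _ _ _ (ltn0Sn _) (ecb_odd_cong n pr n1).
have [c4 c4p h4] := congE _ _ _ _ (ltn0Sn _) (ecb_sqr_cong2 n pr).
have [c5 c5p h5] := congE _ _ _ _ (ltn0Sn _) (sum_ecb2_tail n pr n1).
have [c6 c6p h6] := congE _ _ _ _ (ltn0Sn _) (sum_lin_ecb2_tail n pr n1).
have [c7 c7p h7] := congE _ _ _ _ (ltn0Sn _) (csum_cong n pr).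
have [c8 c8p h8] := congE _ _ _ _ (ltn0Sn _) (exp2_eta n d eta pr d2 dp etap heta).
have Pp : (pp n)%:R \is a pint (pp n) by exact: rpred_nat.
have i2 := pint_inv2 n pr; have i4 := pint_inv4 n pr.
have ap := pint_alth n pr; have bp := pint_alth2 n pr.
have sp : (-1) ^+ n \is a pint (pp n) by rewrite rpredX // rpredN1.
have s2 : ((-1) ^+ n) ^+ 2 = 1 :> rat by rewrite sqrr_sign.
have q1 : \sum_(0 <= k < n.+1) 'C(2 * k, k)%:R / 8%:R ^+ k
  = \sum_(0 <= k < n.+1) ecb k / 2%:R ^+ k :> rat.
  by apply: eq_bigr => k _; exact: ecb_halfE.
have q2 : \sum_(0 <= k < n.+1) 'C(2 * k, k)%:R ^+ 2 / 16%:R ^+ k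
  = \sum_(0 <= k < n.+1) ecb k ^+ 2 :> rat.
  by apply: eq_bigr => k _; exact: ecb_sqrE.
have q3 : \sum_(0 <= k < n.+1) k%:R * 'C(2 * k, k)%:R ^+ 2 / 16%:R ^+ k
  = \sum_(0 <= k < n.+1) k%:R * ecb k ^+ 2 :> rat.
  by apply: eq_bigr => k _; rewrite -mulrA ecb_sqrE.
have q4 : \sum_(0 <= k < pp n | (pp n < 2 * k)%N) 'C(2 * k, k)%:R ^+ 2 / 16%:R ^+ k
  = \sum_(n.+1 <= k < pp n) ecb k ^+ 2 :> rat.
  by rewrite sum_gt_half; apply: eq_bigr => k _; exact: ecb_sqrE.
have q5 : \sum_(0 <= k < pp n | (pp n < 2 * k)%N) k%:R * 'C(2 * k, k)%:R ^+ 2 / 16%:R ^+ k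
  = \sum_(n.+1 <= k < pp n) k%:R * ecb k ^+ 2 :> rat.
  by rewrite sum_gt_half; apply: eq_bigr => k _; rewrite -mulrA ecb_sqrE.
rewrite q1 q2 q3 q4 q5 {q1 q2 q3 q4 q5} sum_k_ecb2_half sum_k_ecb2 -/(csum n).
have x2 : 2%:R ^+ (pp n) = 2 * (d * (1 + (pp n)%:R * eta)) ^+ 2 :> rat.
  by rewrite -heta exprS -exprM [(n * 2)%N]mulnC.
rewrite x2 [(-1) ^+ n.+1]exprS {x2 heta}.
move: h1 h2 h3 h4 h5 h6 h7 h8 he.
set P : rat := (pp n)%:R in Pp *.
set S1 := \sum_(0 <= k < n.+1) ecb k / 2%:R ^+ k.
set S2 := \sum_(0 <= k < n.+1) ecb k ^+ 2.
set S4 := \sum_(n.+1 <= k < pp n) ecb k ^+ 2.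
set S5 := \sum_(n.+1 <= k < pp n) (4 * k%:R + 1) * ecb k ^+ 2.
set s : rat := (-1) ^+ n in sp s2 *.
set T := csum n; set U := ecb_odd n; set A := alth n in ap *; set B := alth2 n in bp *.
set u := ecb n.
move=> h1 h2 h3 h4 h5 h6 h7 h8 he.
have eS2 : S2 = s * (1 - P ^+ 2 * (U / 2) + P ^+ 4 * c2).
  by rewrite -h2 mulrA -expr2 s2 mul1r.
have p0 : (0 < pp n)%N by [].
repeat split; apply: cong_ratcong.
- apply: (@cong_of _ _ _ _ (c1 - s * d * 4%:R^-1 * e)) => //; first by pint_split.
  rewrite -/P h1 he.
  (* The square of [s] arises from the sign in [legendre_neg2] times the sign in [euler_cong]. *)
  transitivity (d + s ^+ 2 * d * P ^+ 2 * B / 8 + P ^+ 3 * c1); last by field.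
  by rewrite s2 mul1r.
- apply: (@cong_of _ _ _ _ (s * (P * c2 - 2%:R^-1 * c3) - e)) => //; first by pint_split.
  by rewrite -/P eS2 h3 he; field.
- apply: (@cong_of _ _ _ _ (4%:R^-1 * (- 2 * A + P * c4 - s * (P * c2 - 2%:R^-1 * c3) + e))) => //.
    by pint_split.
  by rewrite -/P eS2 h3 he h4; field.
- apply: (@cong_of _ _ _ _ (c5 + 2 * e)) => //; first by pint_split.
  by rewrite -/P h5 he; field.
- apply: (@cong_of _ _ _ _ (4%:R^-1 * (c6 - c5 - 2 * e))) => //; first by pint_split.
  by rewrite -/P h5 h6 he; field.
- apply: (@cong_of _ _ _ _ (c2 + 4%:R^-1 * c7)) => //; first by pint_split.
  rewrite -/P h2.
  have -> : 3 / 8 * P * T = P / 4 * (3 / 2 * T) by field.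
  by rewrite h7; field.
- apply: (@cong_of _ _ _ _ (4%:R^-1 * (c4 - 2 * c8 - 2 * eta ^+ 2 - s * (c2 + 4%:R^-1 * c7)))) => //.
    by pint_split.
  rewrite -/P [(d * _) ^+ 2]exprMn d2 h4 eS2.
  have -> : s * (3 / 32) * P * T = s * (P / 16 * (3 / 2 * T)) by field.
  (* This matches [ecb n ^+ 2 = 1 - 2 P A] with [2^p - 1 = 1 + 4 P eta] modulo [P^2]. *)
  have eA : A = P * c8 - 2 * eta by rewrite h8 expr1; ring.
  by rewrite h7 eA; field.
Qed.
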